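(* There is a universal constant $C>0$ such that for all real $p,\lambda\ge2$, every $\lambda$-doubling subset $\mathcal D$ of $L_p$ satisfies $$\mathrm{SEP}(\mathcal D)\le C\big(p^2\sqrt{\log p}\big)\sqrt{\log\lambda}.$$
   Context: $L_p$ denotes the real Banach space $L_p([0,1])$ with Lebesgue measure. For an integer $\lambda\ge2$, a metric space $(\mathcal M,d)$ is $\lambda$-doubling if for every $r\ge0$ and $x\in\mathcal M$ there are $y_1,\dots,y_\lambda\in\mathcal M$ with $B_{\mathcal M}(x,2r)\subseteq\bigcup_{i=1}^{\lambda} B_{\mathcal M}(y_i,r)$, where $B_{\mathcal M}(u,\rho)=\{v: d(u,v)\le\rho\}$; for real $\lambda\ge 2$, $\lambda$-doubling means $\lfloor\lambda\rfloor$-doubling. Subsets carry the restricted metric. For a partition $\mathcal P$ of $\mathcal M$ and $x\in\mathcal M$, $\mathcal P(x)$ is the element of $\mathcal P$ containing $x$. A random partition $\mathcal P$ of $\mathcal M$ consists of a probability space $(\Omega,\mathbb P)$ and set-valued maps $\Gamma^1,\Gamma^2,\ldots:\Omega\to2^{\mathcal M}$ that are strongly measurable (for every $i$ and every closed $E\subseteq\mathcal M$, $\{\omega: E\cap\Gamma^i(\omega)\ne\emptyset\}$ is $\mathbb P$-measurable) such that for every $\omega$, $\mathcal P^\omega=\{\Gamma^k(\omega)\}_{k\in\mathbb N}$ is a partition of $\mathcal M$ (empty clusters allowed). For $\Delta>0$, it is $\Delta$-bounded if $\mathrm{diam}_{\mathcal M}(\mathcal P^\omega(x))\le\Delta$ for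 all $\omega\in\Omega$, $x\in\mathcal M$. For $\sigma\ge0$, a $\Delta$-bounded random partition is $\sigma$-separating if $\mathbb P[\mathcal P(x)\ne\mathcal P(y)]\le\frac{\sigma}{\Delta}d(x,y)$ for all $x,y\in\mathcal M$. $\mathrm{SEP}(\mathcal M)$ is the infimum over $\sigma\ge0$ such that for every $\Delta>0$ there is a $\Delta$-bounded $\sigma$-separating random partition of $\mathcal M$ ($\infty$ if no such $\sigma$ exists). *)

(* Defs.v *)
From HB Require Import structures.
From mathcomp Require Import all_boot all_order all_algebra.
From mathcomp Require Import all_classical all_reals all_analysis.
From mathcomp Require Import measurable_realfun.

Set Implicit Arguments.
Unset Strict Implicit.
Unset Printing Implicit Defensive.
Import Order.TTheory GRing.Theory Num.Theory.
Import numFieldNormedType.Exports.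
Local Open Scope classical_set_scope.
Local Open Scope ring_scope.

Section Lspace_metric.
Context d (T : measurableType d) (R : realType).
Variables (mu : {measure set T -> \bar R}) (p : \bar R) (p1 : (1 <= p)%E).
Local Notation Lp := (LspaceType mu p1).
Local Notation N := (Lnorm mu p).

HB.instance Definition _ := gen_eqMixin Lp.
HB.instance Definition _ := gen_choiceMixin Lp.

(* The elements of Lp are classes of functions modulo equality mu-a.e. and
   coerce to functions through a representative; the norm of the difference
   does not depend on the representatives. *)
Definition Lspace_dist (f g : Lp) : R := fine (N (EFin \o (f \- g : T -> R))).

Lemma Lspace_measurable (f : Lp) : measurable_fun [set: T] (f : T -> R).
Proof. exact: (measurable_funPT (repr (LebesgueSpace.sort f))). Qed.

Let norm_oppr (u : T -> R) : N (EFin \o (\- u)) = N (EFin \o u).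
Proof. by rewrite -[RHS]oppe_Lnorm. Qed.

Lemma Lspace_distE (f g : Lp) :
  (Lspace_dist f g)%:E = N (EFin \o (f \- g : T -> R)).
Proof.
rewrite /Lspace_dist fineK// ge0_fin_numE ?Lnorm_ge0//.
have mNg := measurable_funN (Lspace_measurable g).
apply: (le_lt_trans (eminkowski mu (Lspace_measurable f) mNg p1)).
have := norm_oppr (g : T -> R); rewrite /comp/= => ->.
apply: lte_add_pinfty; exact: Lebesgue_finite.
Qed.

Lemma Lspace_dist_xx (f : Lp) : Lspace_dist f f = 0.
Proof.
apply/EFin_inj; rewrite Lspace_distE (_ : EFin \o _ = cst 0%E).
  by rewrite Lnorm0// gt_eqF// (lt_le_trans _ p1).
by apply/funext => x /=; rewrite subrr.
Qed.

Lemma Lspace_dist_sym (f g : Lp) : Lspace_dist f g = Lspace_dist g f.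
Proof.
apply/EFin_inj; rewrite !Lspace_distE -norm_oppr; congr Lnorm.
by apply/funext => x /=; rewrite opprB.
Qed.

Lemma Lspace_dist_triangle (g f h : Lp) :
  Lspace_dist f h <= Lspace_dist f g + Lspace_dist g h.
Proof.
rewrite -lee_fin EFinD !Lspace_distE.
have mB (u v : Lp) : measurable_fun [set: T] (u \- v : T -> R).
  exact: measurable_funB (Lspace_measurable u) (Lspace_measurable v).
apply: le_trans (eminkowski mu (mB f g) (mB g h) p1).
rewrite le_eqVlt; apply/orP; left; apply/eqP; congr Lnorm.
by apply/funext => x /=; rewrite addrA subrK.
Qed.

Lemma Lspace_dist_eq0 (f g : Lp) : Lspace_dist f g = 0 -> f = g.
Proof.
move=> fg0; have N0 : N (EFin \o (f \- g : T -> R)) = 0%E.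
  by rewrite -Lspace_distE fg0.
have mB : measurable_fun [set: T] (EFin \o (f \- g : T -> R)).
  apply/measurable_EFinP.
  exact: measurable_funB (Lspace_measurable f) (Lspace_measurable g).
have /= ae0 := Lnorm_eq0_eq0 mB (lt_le_trans lte01 p1) N0.
have : LebesgueSpace.sort f = LebesgueSpace.sort g.
  rewrite -[LHS]reprK -[RHS]reprK; apply/eqmodP/asboolP.
  apply: filterS ae0 => x + _ => /(_ I) [] /eqP.
  by rewrite subr_eq0 => /eqP.
case: f g {fg0 N0 mB ae0} => [f [[fP]]] [g [[gP]]] /= fg.
by move: gP; rewrite -fg => gP; rewrite (Prop_irrelevance fP gP).
Qed.

HB.instance Definition _ := isMetric.Build R Lp
  Lspace_dist_xx Lspace_dist_eq0 Lspace_dist_sym Lspace_dist_triangle.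

End Lspace_metric.

Section subset_metric.
Context (R : realType) (X : metricType R) (A : set X).

Let dist (x y : A) : R := mdist (\val x) (\val y).

Let dist_ge0 x y : 0 <= dist x y. Proof. exact: mdist_ge0. Qed.

Let dist_positivity x y : dist x y = 0 -> x = y.
Proof. by move/mdist_positivity/val_inj. Qed.

Let ballEdist x e : ball x e = [set y | dist x y < e].
Proof. by rewrite -initial_ballE ballEmdist. Qed.

HB.instance Definition _ := @PseudoMetric_isMetric.Build R A
  dist dist_ge0 dist_positivity ballEdist.

End subset_metric.

Definition lebesgue01 (R : realType) :
    {measure set (measurableTypeR R) -> \bar R} :=
  mrestr lebesgue_measure (measurable_itv `[0 : R, 1]).

Lemma le2_le1e (R : realType) (p : R) : 2 <= p -> (1 <= p%:E)%E.
Proof. by move=> p2; rewrite lee_fin (le_trans _ p2)// ler1n. Qed.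

(* L_p([0,1]) for p >= 2 with the metric of its norm, realized as the
   functions on the line modulo equality almost everywhere on [0,1]. *)
Definition L_ (R : realType) (p : R) (p2 : 2 <= p) : Type :=
  LspaceType (lebesgue01 R) (le2_le1e p2).
HB.instance Definition _ (R : realType) (p : R) (p2 : 2 <= p) :=
  Metric.on (L_ p2).

Section separation.
Context (R : realType) (M : metricType R).

(* closed_ball of the library is the closure of the open ball, which can be
   smaller than this set. *)
Definition cball (x : M) (r : R) : set M := [set y | mdist x y <= r].

Definition doubling (n : nat) :=
  forall (r : R) (x : M), 0 <= r ->
    exists y : 'I_n -> M, cball x (2 * r) `<=` \bigcup_i cball (y i) r.

Definition rdoubling (lambda : R) := doubling (Num.truncn lambda).

Definition diam (A : set M) : \bar R :=
  ereal_sup [set (mdist a.1 a.2)%:E | a in A `*` A].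

Definition strongly_measurable d (Omega : measurableType d)
    (Gamma : Omega -> set M) :=
  forall E : set M, closed E ->
    measurable [set w | E `&` Gamma w !=set0].

Definition clusters (T : Type) (Gamma : nat -> T -> set M) (w : T) :
  set (set M) := range (Gamma^~ w).

Definition cluster_at (P : set (set M)) (x : M) : set M :=
  xget set0 [set A | P A /\ A x].

(* [partition] asks for nonempty blocks, while clusters may be empty. *)
Definition random_partition d (Omega : measurableType d)
    (Gamma : nat -> Omega -> set M) :=
  (forall k, strongly_measurable (Gamma k)) /\
  (forall w, partition (clusters Gamma w `\ set0) id [set: M]).

Definition bounded_partition (Delta : R) (T : Type)
    (Gamma : nat -> T -> set M) :=
  forall w x, (diam (cluster_at (clusters Gamma w) x) <= Delta%:E)%E.

Definition separating (sigma Delta : R) d (Omega : measurableType d)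
    (P : probability Omega R) (Gamma : nat -> Omega -> set M) :=
  forall x y : M,
    (P [set w | cluster_at (clusters Gamma w) x <>
                cluster_at (clusters Gamma w) y]
     <= (sigma / Delta * mdist x y)%:E)%E.

Definition has_separating_partitions (sigma : R) :=
  forall Delta : R, 0 < Delta ->
    exists (d : measure_display) (Omega : measurableType d)
           (P : probability Omega R) (Gamma : nat -> Omega -> set M),
      [/\ random_partition Gamma, bounded_partition Delta Gamma &
          separating sigma Delta P Gamma].

Definition SEP : \bar R :=
  ereal_inf [set sigma%:E | sigma in
    [set sigma | 0 <= sigma /\ has_separating_partitions sigma]].

End separation.

Arguments doubling {R} M n.
Arguments rdoubling {R} M lambda.
Arguments SEP {R} M.

(* Main.v *)
Require Import Defs.
From HB Require Import structures.
From mathcomp Require Import all_boot all_order all_algebra.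
From mathcomp Require Import all_classical all_reals all_analysis.
From mathcomp Require Import fingroup perm measurable_realfun ring lra.

Set Implicit Arguments.
Unset Strict Implicit.
Unset Printing Implicit Defensive.
Import Order.TTheory GRing.Theory Num.Theory.
Import numFieldNormedType.Exports.
Local Open Scope classical_set_scope.
Local Open Scope ring_scope.

(* A random partition is sampled from a deterministic object: a partition of unity
   whose members have small support and which is Lipschitz for the l_1 norm.

   Hilbert space.  Given n centres z_i, code a point x by the product measure P_x
   on sign vectors whose means are proportional to the coordinates of x, and let
   x have weight P_x(z_i is the centre nearest to the sign vector) at z_i.  This
   is Lipschitz in x because the chi-squared divergence of product measures is
   explicit, with a dimension-free constant, and by Chernoff's bound a mean scale
   of order sqrt(log n) makes the weight of the far centres negligible; they are
   removed by a cutoff.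

   L_p.  On a ball of centre c and radius K r with K = 1 + 1/(6p) apply the above
   to the images under the Mazur map f |-> sgn(f) |f|^(p/2) of (x - c)/(K r), which
   is O(p)-Lipschitz into L_2.  If the images of x and z are close in L_2 then x
   lies within r of the recentred point c + (z - c)/p: subtracting (z - c)/p
   shrinks the norm by a factor 1 - Omega(1/p).  So balls of radius K r are
   partitioned into subsets of balls of radius r, at the cost
   A = O(p sqrt(log n)), where n <= lambda^(O(log p)) by doubling.

   Scales.  A partition of unity with constant s at scale K r thus refines to one
   with constant s/K + A at scale r.  Starting from any finite s, which a doubling
   space admits, and iterating, the constant tends to
   A K/(K - 1) = O(p A) = O(p^2 sqrt(log p) sqrt(log lambda)). *)

(** * Bernoulli measures on sign vectors *)

Section normalization.
Context {R : realType}.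

Lemma ler_norm_mulB (a a' b b' : R) : 0 <= b -> 0 <= a' ->
  `|a * b - a' * b'| <= `|a - a'| * b + a' * `|b - b'|.
Proof.
move=> b0 a0; have -> : a * b - a' * b' = (a - a') * b + a' * (b - b') by ring.
by apply: le_trans (ler_normD _ _) _; rewrite !normrM (ger0_norm b0) (ger0_norm a0).
Qed.

Definition clamp (y : R) : R := Num.max 0 (Num.min 1 y).

Lemma clamp_ge0 y : 0 <= clamp y. Proof. by rewrite le_max lexx. Qed.

Lemma clamp_le1 y : clamp y <= 1. Proof. by rewrite ge_max ler01 ge_min lexx. Qed.

Lemma clamp_lipschitz (a b : R) : `|clamp a - clamp b| <= `|a - b|.
Proof.
wlog ab : a b / b <= a.
  by move=> W; have [/W//|/ltW/W] := leP b a; rewrite distrC [leRHS]distrC.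
rewrite [leRHS]ger0_norm ?subr_ge0// ler_norml.
rewrite /clamp /Num.max /Num.min.
case: (ltP 1 a) => a1; case: (ltP 1 b) => b1.
- by rewrite ltr01; apply/andP; split; lra.
- by rewrite ltr01; case: ifPn; rewrite -?leNgt => ?; apply/andP; split; lra.
- lra.
- by do 2 case: ifPn; rewrite -?leNgt => ? ?; apply/andP; split; lra.
Qed.

(** Each difference splits as (f - g)/F + g (G - F)/(F G), with F and G the two sums. The second
    terms add up to at most |F - G|/F, again bounded by the l_1 distance over F: hence the factor
    2. *)
Lemma normalize_lipschitz (I : finType) (f g : I -> R) (h : R) :
  0 < h -> (forall i, 0 <= f i) -> (forall i, 0 <= g i) ->
  h <= \sum_i f i -> h <= \sum_i g i ->
  \sum_i `|f i / (\sum_i f i) - g i / (\sum_i g i)| <=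
    2 / h * \sum_i `|f i - g i|.
Proof.
move=> h0 f0 g0 hf hg.
set F := \sum_i f i; set G := \sum_i g i; set D := \sum_i `|f i - g i|.
have F0 : 0 < F by apply: lt_le_trans hf.
have G0 : 0 < G by apply: lt_le_trans hg.
have D0 : 0 <= D by exact: sumr_ge0.
have FG : `|F - G| <= D by rewrite /F /G -sumrB; exact: ler_norm_sum.
have E i : `|f i / F - g i / G| <= `|f i - g i| / F + g i * (`|F - G| / (F * G)).
  have -> : f i / F - g i / G = (f i - g i) / F + g i * ((G - F) / (F * G)).
    by field; rewrite !gt_eqF.
  apply: le_trans (ler_normD _ _) _; rewrite !normrM normfV (ger0_norm (g0 i)).
  by rewrite normfV (gtr0_norm (mulr_gt0 F0 G0)) (gtr0_norm F0) [`|G - F|]distrC.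
apply: le_trans (ler_sum _ (fun i _ => E i)) _.
rewrite big_split /= -mulr_suml -mulr_suml -/D -/G.
have -> : D / F + G * (`|F - G| / (F * G)) = (D + `|F - G|) / F.
  by field; rewrite !gt_eqF.
rewrite mulrAC ler_pM ?invr_ge0 ?(ltW F0) ?addr_ge0//; first by lra.
by rewrite lef_pV2 ?posrE.
Qed.

End normalization.

Section sign_vectors.
Context {R : realType} {J : finType}.
Implicit Types (a b : J -> R) (e : {ffun J -> bool}).

Definition sqdist a b := \sum_j (a j - b j) ^+ 2.

(* The product measure on sign vectors whose j-th sign has mean a j. *)
Definition bern a e : R := \prod_j ((1 + (-1) ^+ e j * a j) / 2).

Lemma sqdist_ge0 a b : 0 <= sqdist a b.
Proof. by apply: sumr_ge0 => j _; exact: sqr_ge0. Qed.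

Lemma sum_prod_signs (F : J -> bool -> R) :
  \sum_(e : {ffun J -> bool}) \prod_j F j (e j) =
  \prod_j (F j true + F j false).
Proof. by rewrite -bigA_distr_bigA; apply: eq_bigr => j _; rewrite big_bool. Qed.

Lemma sum_bern a : \sum_e bern a e = 1.
Proof.
rewrite /bern (sum_prod_signs (fun j (b : bool) => (1 + (-1) ^+ b * a j) / 2)).
by rewrite big1// => j _; rewrite expr0 expr1; field.
Qed.

Lemma bern_gt0 a e : (forall j, `|a j| <= 2^-1) -> 0 < bern a e.
Proof.
move=> a2; apply: prodr_gt0 => j _; have := a2 j; rewrite ler_norml => /andP[].
by case: (e j); rewrite ?expr0 ?expr1 => ? ?; lra.
Qed.

(** The chi-squared divergence is the sum of P_a^2 / P_b minus 1, and P_a^2 / P_b is again a product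
    over the coordinates, so the sum over sign vectors factorizes. *)
Lemma bern_chi2 a b : (forall j, `|b j| <= 2^-1) ->
  \sum_e (bern a e - bern b e) ^+ 2 / bern b e =
  \prod_j (1 + (a j - b j) ^+ 2 / (1 - b j ^+ 2)) - 1.
Proof.
move=> b2.
have E e : (bern a e - bern b e) ^+ 2 / bern b e =
    bern a e ^+ 2 / bern b e - 2 * bern a e + bern b e.
  by have := bern_gt0 e b2 => /lt0r_neq0 ?; field.
rewrite (eq_bigr _ (fun e _ => E e)) big_split /= sum_bern sumrB -mulr_sumr.
rewrite sum_bern mulr1 -addrA; congr (_ + _); last by lra.
transitivity (\sum_(e : {ffun J -> bool}) \prod_j (((1 + (-1) ^+ e j * a j) / 2) ^+ 2 /
    ((1 + (-1) ^+ e j * b j) / 2))).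
  apply: eq_bigr => e _; rewrite big_split /= prodfV; congr (_ * _).
  by rewrite /bern -prodrXl.
rewrite (sum_prod_signs (fun j (c : bool) => ((1 + (-1) ^+ c * a j) / 2) ^+ 2 /
    ((1 + (-1) ^+ c * b j) / 2))).
apply: eq_bigr => j _; rewrite expr0 expr1.
have := b2 j; rewrite ler_norml => /andP[b1 b3].
have h1 : 1 + b j != 0 by rewrite gt_eqF//; lra.
have h2 : 1 - b j != 0 by rewrite gt_eqF//; lra.
have h3 : 1 - b j ^+ 2 != 0.
  by rewrite (_ : _ - _ = (1 + b j) * (1 - b j)) ?mulf_neq0//; ring.
by rewrite !mulN1r !mul1r; field; rewrite h1 h2 h3.
Qed.

Lemma prod1D_le (s : J -> R) : (forall j, 0 <= s j) ->
  \prod_j (1 + s j) <= expR (\sum_j s j).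
Proof.
move=> s0; rewrite expR_sum; apply: ler_prod => j _.
by rewrite expR_ge1Dx andbT addr_ge0.
Qed.

Lemma expR_le_inv (x : R) : x < 1 -> expR x <= (1 - x)^-1.
Proof.
move=> x1; rewrite -[x]opprK expRN lef_pV2 ?posrE ?expR_gt0 ?opprK ?subr_gt0//.
exact: expR_ge1Dx.
Qed.

(** For squared distance S at most 1/2 the divergence is at most exp(4S/3) - 1 <= 4S, and
    Cauchy-Schwarz turns this into a bound in total variation. For larger S the trivial bound 2 is
    already below 3 sqrt S. *)
Lemma bern_tv a b : (forall j, `|a j| <= 2^-1) -> (forall j, `|b j| <= 2^-1) ->
  \sum_e `|bern a e - bern b e| <= 3 * Num.sqrt (sqdist a b).
Proof.
move=> a2 b2; set S := sqdist a b; have S0 : 0 <= S by exact: sqdist_ge0.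
have [S2|S2] := ltP 2^-1 S.
  apply: (@le_trans _ _ 2); last first.
    rewrite -ler_pdivrMl// -[leLHS]ger0_norm; last by lra.
    by rewrite -sqrtr_sqr ler_sqrt ?S0//; lra.
  apply: (@le_trans _ _ (\sum_e (bern a e + bern b e))).
    apply: ler_sum => e _; apply: le_trans (ler_normB _ _) _.
    by rewrite !gtr0_norm// bern_gt0.
  by rewrite big_split /= !sum_bern; lra.
have [S00|Sn0] := eqVneq S 0.
  rewrite S00 sqrtr0 mulr0 big1// => e _; apply/eqP; rewrite normr_eq0 subr_eq0.
  apply/eqP/eq_bigr => j _; suff -> : a j = b j by [].
  apply/eqP; rewrite -subr_eq0 -sqrf_eq0.
  by rewrite (psumr_eq0P (fun j _ => sqr_ge0 (a j - b j)) S00).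
have Sp : 0 < S by rewrite lt0r Sn0.
set k := 2 * Num.sqrt S; have k0 : 0 < k by rewrite mulr_gt0// sqrtr_gt0.
have kk : k ^+ 2 = 4 * S by rewrite exprMn sqr_sqrtr//; lra.
have X : \sum_e (bern a e - bern b e) ^+ 2 / bern b e <= k ^+ 2.
  rewrite bern_chi2//.
  set s := fun j => (a j - b j) ^+ 2 / (1 - b j ^+ 2).
  have bj j : 3 / 4 <= 1 - b j ^+ 2.
    by have := b2 j; rewrite ler_norml => /andP[? ?]; nra.
  have sj j : 0 <= s j <= 4 / 3 * (a j - b j) ^+ 2.
    have bj0 : 0 < 1 - b j ^+ 2 by rewrite (lt_le_trans _ (bj j)).
    rewrite divr_ge0 ?sqr_ge0 ?(ltW bj0)//=.
    rewrite [leRHS]mulrC ler_wpM2l ?sqr_ge0//.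
    rewrite -[leRHS]invrK lef_pV2 ?posrE ?invf_div//.
  have sS : \sum_j s j <= 4 / 3 * S.
    by rewrite mulr_sumr; apply: ler_sum => j _; case/andP: (sj j).
  have := prod1D_le (fun j => proj1 (andP (sj j))).
  have := expR_le_inv (x := 4 / 3 * S); have -> : 4 / 3 * S < 1 by lra.
  move=> /(_ isT) e1 p1.
  apply: (@le_trans _ _ ((1 - 4 / 3 * S)^-1 - 1)).
    by rewrite lerD2r (le_trans p1)// (le_trans _ e1)// ler_expR.
  by rewrite kk lerBlDr -[leLHS]mul1r ler_pdivrMr; [nra|lra].
apply: (@le_trans _ _ k); last by rewrite ler_wpM2r ?sqrtr_ge0// ler_nat.
(* Cauchy-Schwarz in the form of the termwise inequality |d| <= (d^2/(q k) + k q)/2; dividing by [k]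
   is why S = 0 was settled apart. *)
apply: (@le_trans _ _ (\sum_e ((bern a e - bern b e) ^+ 2 / bern b e / k
    + k * bern b e) / 2)).
  apply: ler_sum => e _; have p0 := bern_gt0 e b2.
  rewrite -real_normK ?num_real//; set d := `|_|.
  rewrite -subr_ge0; set q := bern b e in p0 *.
  have -> : (d ^+ 2 / q / k + k * q) / 2 - d = (d - k * q) ^+ 2 / (2 * q * k).
    by field; rewrite !gt_eqF.
  by rewrite divr_ge0 ?sqr_ge0// !mulr_ge0 ?(ltW p0) ?(ltW k0).
rewrite -mulr_suml big_split /= -mulr_suml -mulr_sumr sum_bern mulr1.
rewrite ler_pdivrMr// -lerBrDr.
by rewrite ler_pdivrMr// (le_trans X)//; nra.
Qed.

Lemma expR_le_quadratic (x : R) : x <= 2^-1 -> expR x <= 1 + x + 2 * x ^+ 2.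
Proof.
move=> x2; apply: le_trans (expR_le_inv _) _; first by lra.
have x1 : 0 < 1 - x by lra.
rewrite -[leLHS]mul1r ler_pdivrMr//.
have : 0 <= x ^+ 2 * (1 - 2 * x) by rewrite mulr_ge0 ?sqr_ge0//; lra.
by rewrite -[2 in X in _ -> X]/(2 : R); nra.
Qed.

(** After factoring out expR (l m) the exponents are centred: the first-order terms cancel and the
    quadratic ones add up to 2 l^2 (1 - m^2). *)
Lemma bern_mgf1 (m l : R) : `|m| <= 2^-1 -> `|l| <= 4^-1 ->
  (1 - m) / 2 * expR (- l) + (1 + m) / 2 * expR l <=
  expR (l * m + 2 * l ^+ 2).
Proof.
rewrite !ler_norml => /andP[m1 m2] /andP[l1 l2].
have E1 : expR l = expR (l * (1 - m)) * expR (l * m).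
  by rewrite -expRD; congr expR; ring.
have E2 : expR (- l) = expR (- (l * (1 + m))) * expR (l * m).
  by rewrite -expRD; congr expR; ring.
rewrite E1 E2 expRD !mulrA -mulrDl mulrC ler_wpM2l ?expR_ge0//.
have h1 : expR (l * (1 - m)) <= 1 + l * (1 - m) + 2 * (l * (1 - m)) ^+ 2.
  by apply: expR_le_quadratic; nra.
have h2 : expR (- (l * (1 + m))) <=
    1 + - (l * (1 + m)) + 2 * (- (l * (1 + m))) ^+ 2.
  by apply: expR_le_quadratic; nra.
apply: le_trans (expR_ge1Dx _).
apply: le_trans (lerD (ler_wpM2l _ h2) (ler_wpM2l _ h1)) _; [lra|lra|].
rewrite -subr_ge0 [X in 0 <= X](_ : _ = 2 * l ^+ 2 * m ^+ 2); last by field.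
exact: mulr_ge0 (mulr_ge0 (ler0n _ _) (sqr_ge0 _)) (sqr_ge0 _).
Qed.

(** Chernoff's bound: the indicator of the half-space is dominated by an exponential, whose mean is
    a product over the signs. *)
Lemma bern_tail a b (beta s : R) : 0 <= s -> (forall j, `|a j| <= 2^-1) ->
  (forall j, `|s * b j| <= 4^-1) ->
  \sum_(e : {ffun J -> bool} | beta <= \sum_j (-1) ^+ e j * b j) bern a e <=
  expR (s * (\sum_j a j * b j - beta) + 2 * s ^+ 2 * \sum_j b j ^+ 2).
Proof.
move=> s0 a2 b4.
apply: (@le_trans _ _
    (\sum_(e : {ffun J -> bool})
       bern a e * expR (s * (\sum_j (-1) ^+ e j * b j - beta)))).
  rewrite [leRHS](bigID (fun e : {ffun J -> bool} =>
    beta <= \sum_j (-1) ^+ e j * b j)) /=.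
  rewrite -[leLHS]addr0 lerD//; last first.
    by apply: sumr_ge0 => e _; rewrite mulr_ge0 ?expR_ge0// ltW ?bern_gt0.
  apply: ler_sum => e be; rewrite ler_peMr ?(ltW (bern_gt0 _ _))//.
  by rewrite -[leLHS]expR0 ler_expR mulr_ge0// subr_ge0.
under eq_bigr => e _.
  rewrite mulrBr expRD mulrA mulr_sumr expR_sum -big_split /=.
  over.
rewrite -mulr_suml.
rewrite (sum_prod_signs (fun j (c : bool) => (1 + (-1) ^+ c * a j) / 2 *
  expR (s * ((-1) ^+ c * b j)))).
rewrite mulrBr -addrA [- _ + _]addrC addrA expRD ler_wpM2r ?expR_ge0//.
rewrite !mulr_sumr -big_split expR_sum /=; apply: ler_prod => j _.
rewrite expr0 expr1 !mul1r !mulN1r mulrN.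
have -> : s * (a j * b j) + 2 * s ^+ 2 * b j ^+ 2 =
  (s * b j) * a j + 2 * (s * b j) ^+ 2 by ring.
rewrite bern_mgf1// andbT; have := a2 j; rewrite ler_norml => /andP[? ?].
by rewrite addr_ge0// mulr_ge0 ?expR_ge0//; lra.
Qed.

End sign_vectors.
(** * Lipschitz partitions in Hilbert space *)

Section psd_kernel.
Context {R : realType} {X : Type}.
Implicit Types (k : X -> X -> R).

(** Hilbert space appears only through Gram kernels: k x y stands for an inner product and [kdist]
    for the squared distance. *)
Definition psd k := forall s : seq (R * X),
  0 <= \sum_(a <- s) \sum_(b <- s) a.1 * b.1 * k a.2 b.2.

Definition kdist k x y := k x x - 2 * k x y + k y y.

Lemma psd_diag k x : psd k -> 0 <= k x x.
Proof. by move/(_ [:: (1, x)]); rewrite !big_seq1 /= !mul1r. Qed.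

Lemma psd_kdist k x y : (forall x y, k x y = k y x) -> psd k -> 0 <= kdist k x y.
Proof.
move=> ks /(_ [:: (1, x); (-1, y)]); rewrite !big_cons !big_nil /= (ks y x).
by congr (0 <= _); rewrite /kdist; ring.
Qed.

Lemma discriminant_le (a b c : R) :
  (forall l m : R, 0 <= l ^+ 2 * a + 2 * (l * m) * b + m ^+ 2 * c) ->
  b ^+ 2 <= a * c.
Proof.
move=> H; have a0 : 0 <= a by have := H 1 0; nra.
have [a00|an0] := eqVneq a 0.
  (* With a = 0 these values give - (c + 2) b^2 >= 0, which forces b = 0. *)
  rewrite a00 mul0r; have := H (- (c + 1)) b; rewrite a00.
  have c0 : 0 <= c by have := H 0 1; nra.
  by have := sqr_ge0 b; nra.
have ap : 0 < a by rewrite lt0r an0.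
have := H (- b) a => h.
have : 0 <= a * (a * c - b ^+ 2) by nra.
by rewrite pmulr_rge0// subr_ge0.
Qed.

Lemma psd_cauchy k x y : (forall x y, k x y = k y x) -> psd k ->
  k x y ^+ 2 <= k x x * k y y.
Proof.
move=> ks kp; apply: discriminant_le => l m.
have := kp [:: (l, x); (m, y)]; rewrite !big_cons !big_nil /= (ks y x).
by congr (0 <= _); ring.
Qed.

Lemma psd_triangle k x y z : (forall x y, k x y = k y x) -> psd k ->
  Num.sqrt (kdist k x z) <= Num.sqrt (kdist k x y) + Num.sqrt (kdist k y z).
Proof.
move=> ks kp.
set P := kdist k x y; set Q := kdist k y z.
(* The inner product of x - y with y - z; its Cauchy-Schwarz inequality comes from testing [psd] on
   l (x - y) + m (y - z). *)
pose I := k x y - k x z - k y y + k y z.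
have P0 : 0 <= P by exact: psd_kdist.
have Q0 : 0 <= Q by exact: psd_kdist.
have I2 : I ^+ 2 <= P * Q.
  apply: discriminant_le => l m.
  have := kp [:: (l, x); (m - l, y); (- m, z)]; rewrite !big_cons !big_nil /=.
  rewrite (ks y x) (ks z x) (ks z y).
  by congr (0 <= _); rewrite /P /Q /I /kdist; ring.
have IPQ : I <= Num.sqrt P * Num.sqrt Q.
  apply: le_trans (ler_norm _) _.
  by rewrite -sqrtr_sqr -sqrtrM// ler_sqrt// (le_trans (sqr_ge0 _) I2).
rewrite -[leRHS]ger0_norm ?addr_ge0 ?sqrtr_ge0// -sqrtr_sqr ler_sqrt ?sqr_ge0//.
rewrite sqrrD !sqr_sqrtr//.
have -> : kdist k x z = P + I *+ 2 + Q.
  by rewrite /P /Q /I /kdist; ring.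
by rewrite lerD2r lerD2l ler_wMn2r.
Qed.

(** The Gram kernel of the projections on the orthogonal complement of z. Since division by 0 gives
    0, it is k itself when k z z = 0. *)
Definition schur k z x y := k x y - k x z * k z y / k z z.

Lemma schurC k z : (forall x y, k x y = k y x) ->
  forall x y, schur k z x y = schur k z y x.
Proof. by move=> ks x y; rewrite /schur (ks x y) (ks x z) (ks z y); ring. Qed.

Lemma schur_diag k z : schur k z z z = 0.
Proof.
rewrite /schur; have [->|n0] := eqVneq (k z z) 0; first by rewrite !mul0r subr0.
by rewrite mulfK// subrr.
Qed.

(* The Schur quadratic form of s is that of k at s minus its projection on z. *)
Lemma psd_schur k z : (forall x y, k x y = k y x) -> psd k -> psd (schur k z).
Proof.
move=> ks kp s.
pose t := \sum_(a <- s) a.1 * k a.2 z.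
have E1 c : \sum_(a <- s) a.1 * c * k a.2 z = c * t.
  by rewrite mulr_sumr; apply: eq_bigr => a _; ring.
have E : \sum_(a <- s) \sum_(b <- s) a.1 * b.1 * schur k z a.2 b.2 =
   \sum_(a <- s) \sum_(b <- s) a.1 * b.1 * k a.2 b.2 - t ^+ 2 / k z z.
  rewrite expr2 /t !mulr_suml -sumrB; apply: eq_bigr => a _.
  rewrite mulr_sumr mulr_suml -sumrB; apply: eq_bigr => b _.
  by rewrite /schur (ks z b.2); ring.
have := kp ((- (t / k z z), z) :: s); rewrite !big_cons /=.
under [X in 0 <= _ + X]eq_bigr => a _ do rewrite big_cons /=.
rewrite big_split /= E1.
have -> : \sum_(j <- s) - (t / k z z) * j.1 * k z j.2 = - (t / k z z) * t.
  by rewrite [RHS]mulr_sumr; apply: eq_bigr => a _; rewrite (ks z); ring.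
rewrite E; have [z0|n0] := eqVneq (k z z) 0.
  by rewrite z0 invr0; congr (0 <= _); ring.
by congr (0 <= _); field.
Qed.

Lemma schur_zero k z y : (forall x y, k x y = k y x) -> psd k ->
  k y y = 0 -> schur k z y y = 0.
Proof.
move=> ks kp y0; apply/eqP; rewrite eq_le psd_diag ?andbT; last exact: psd_schur.
rewrite /schur y0 sub0r oppr_le0 (ks z y) -expr2.
by rewrite divr_ge0 ?sqr_ge0// psd_diag.
Qed.

Lemma schurE k z x y : psd k -> (forall x y, k x y = k y x) ->
  k x y = schur k z x y +
    k x z / Num.sqrt (k z z) * (k y z / Num.sqrt (k z z)).
Proof.
move=> kp ks; rewrite mulrACA -invfM -expr2 sqr_sqrtr ?psd_diag//.
by rewrite /schur (ks z y) subrK.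
Qed.

(** Gram-Schmidt along the list: each point splits off one coordinate, and the residual kernel k'
    vanishes at all the points treated so far. *)
Lemma psd_coordinates k (s : seq X) : (forall x y, k x y = k y x) -> psd k ->
  exists Phi : 'I_(size s) -> X -> R, exists k',
    [/\ forall x y, k x y = k' x y + \sum_j Phi j x * Phi j y,
        forall x y, k' x y = k' y x, psd k' &
        forall i : 'I_(size s), forall x0, let z := nth x0 s i in k' z z = 0].
Proof.
move=> ks kp; elim: s => [|z s [Phi [k' [kE k's k'p k'0]]]].
  by exists (fun _ _ => 0), k; split=> // [x y|[]//]; rewrite big_ord0 addr0.
pose F x := k' x z / Num.sqrt (k' z z).
exists (fun j => oapp Phi F (unlift ord0 j)), (schur k' z); split.
- move=> x y; rewrite big_ord_recl unlift_none /=.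
  under eq_bigr => j _ do rewrite liftK /=.
  by rewrite kE addrA -schurE.
- exact: schurC.
- exact: psd_schur.
- move=> i x0; have [j ->|->] /= := unliftP ord0 i; last exact: schur_diag.
  by apply: schur_zero => //; exact: k'0.
Qed.

Lemma psd_zero_kdist k x y : (forall x y, k x y = k y x) -> psd k ->
  k x x = 0 -> k y y = 0 -> k x y = 0.
Proof.
move=> ks kp x0 y0; apply/eqP; rewrite -sqrf_eq0 eq_le sqr_ge0 andbT.
by rewrite (le_trans (psd_cauchy _ _ ks kp))// x0 mul0r.
Qed.

End psd_kernel.

(** * Nearest-centre partitions of unity for a Gram kernel *)

Section hilbert_partition.
Context {R : realType}.

Lemma ln2_ge : 2^-1 <= ln 2 :> R.
Proof.
rewrite -[leRHS]opprK -lnV ?posrE// -[2^-1]opprK lerN2.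
rewrite -[X in _ <= X]expRK ler_ln ?posrE ?invr_gt0 ?expR_gt0//.
by apply: le_trans (expR_ge1Dx _); lra.
Qed.

Lemma ln_double_ge (n : nat) : (0 < n)%N -> 2^-1 <= ln n.*2%:R :> R.
Proof.
move=> n0; apply: le_trans ln2_ge _.
by rewrite ler_ln ?posrE ?ltr0n ?double_gt0// ler_nat -muln2 leq_pmull.
Qed.

Section nearest_centre.
Context {J : finType} {X : Type} {n : nat}.
Variables (a : X -> J -> R) (z : 'I_n.+1 -> X).
Hypothesis a2 : forall x j, `|a x j| <= 2^-1.

Let sg (e : {ffun J -> bool}) j : R := (-1) ^+ e j.

Let near e := [arg min_(i < ord0) sqdist (sg e) (a (z i))]%O.

Let near_le e i : sqdist (sg e) (a (z (near e))) <= sqdist (sg e) (a (z i)).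
Proof. by rewrite /near; case: arg_minP => // k _; apply. Qed.

Lemma bernoulli_partition : exists v : 'I_n.+1 -> X -> R,
  [/\ forall i x, 0 <= v i x,
      forall x, \sum_i v i x = 1,
      forall x y,
        \sum_i `|v i x - v i y| <= 3 * Num.sqrt (sqdist (a x) (a y)) &
      forall x i i0,
        sqdist (a x) (a (z i0)) <= sqdist (a x) (a (z i)) / 6 ->
        v i x <= expR (- (sqdist (a x) (a (z i)) / 128))].
Proof.
exists (fun i x => \sum_(e | near e == i) bern (a x) e); split.
- by move=> i x; apply: sumr_ge0 => e _; rewrite ltW// bern_gt0.
- by move=> x; rewrite -[RHS](sum_bern (a x)) [RHS](partition_big near predT).
- move=> x y; apply: le_trans (bern_tv (a2 x) (a2 y)).
  rewrite [leRHS](partition_big near predT)//=; apply: ler_sum => i _.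
  by rewrite -sumrB; exact: ler_norm_sum.
- move=> x i i0 D01.
  set D0 := sqdist _ _ in D01; set D1 := sqdist (a x) (a (z i)) in D01 *.
  (* [b] and [beta] describe the half-space of the vectors at least as close to the image of z i as
     to that of z i0. It contains every sign vector whose nearest centre is z i. *)
  pose b j := a (z i) j - a (z i0) j.
  pose beta := (\sum_j a (z i) j ^+ 2 - \sum_j a (z i0) j ^+ 2) / 2.
  have sqdistE (u : J -> R) : \sum_j u j * b j - beta =
      (sqdist u (a (z i0)) - sqdist u (a (z i))) / 2.
    rewrite /sqdist /beta -!sumrB !mulr_suml -sumrB.
    by apply: eq_bigr => j _; rewrite /b; field.
  have bD : \sum_j b j ^+ 2 <= 2 * (D0 + D1).
    rewrite /D0 /D1 /sqdist -big_split mulr_sumr; apply: ler_sum => j _ /=.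
    have := sqr_ge0 (a x j - a (z i0) j + (a x j - a (z i) j)).
    by rewrite /b; nra.
  apply: (@le_trans _ _
      (\sum_(e : {ffun J -> bool} | beta <= \sum_j (-1) ^+ e j * b j)
         bern (a x) e)).
    rewrite big_mkcond [leRHS]big_mkcond /=; apply: ler_sum => e _.
    have B0 := ltW (bern_gt0 e (a2 x)).
    have [nei|_] := eqVneq (near e) i; last by case: ifP.
    suff -> : beta <= \sum_j (-1) ^+ e j * b j by [].
    by rewrite -subr_ge0 sqdistE divr_ge0// subr_ge0 -nei near_le.
  (* With s = 1/16 the exponent is at most (3 D0 - D1)/64, which is at most - D1/128 because 6 D0 <=
     D1. *)
  apply: le_trans (bern_tail (s := 16^-1) beta _ (a2 x) _) _.
  - by rewrite invr_ge0.
  - move=> j; have := a2 (z i) j; have := a2 (z i0) j.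
    by rewrite !ler_norml /b => /andP[? ?] /andP[? ?]; apply/andP; split; lra.
  by rewrite ler_expR sqdistE -/D0 -/D1; lra.
Qed.

End nearest_centre.

Section kernel_partition.
Context {X : Type} (k : X -> X -> R) (n : nat) (z : 'I_n.+1 -> X).
Hypothesis ks : forall x y, k x y = k y x.
Hypothesis kp : psd k.
Hypothesis k1 : forall x, k x x <= 1.

(* The coordinates of the projection on the span of the z i, each scaled by
   t / sqrt T and repeated T times so as to become at most 1/2. *)
Lemma kernel_bernoulli (t : R) : 0 < t -> exists v : 'I_n.+1 -> X -> R,
  [/\ forall i x, 0 <= v i x,
      forall x, \sum_i v i x = 1,
      forall x y, \sum_i `|v i x - v i y| <= 3 * t * Num.sqrt (kdist k x y) &
      forall x i i0 (al be : R),
        kdist k x (z i0) <= al -> be <= kdist k x (z i) ->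
        40 * al <= be ->
        v i x <= expR (- (t ^+ 2 * be / 640))].
Proof.
move=> t0.
have [Phi [k' [kE k's k'p k'0]]] := psd_coordinates (map z (enum 'I_n.+1)) ks kp.
have zE i : k' (z i) (z i) = 0.
  have si : (i < size (map z (enum 'I_n.+1)))%N by rewrite size_map size_enum_ord.
  have := k'0 (Ordinal si) (z i) => /=; rewrite (nth_map ord0) ?size_enum_ord//.
  by rewrite nth_ord_enum.
have zzE i j : k' (z i) (z j) = 0 by exact: psd_zero_kdist.
set m := size _ in Phi kE k'0.
pose dPhi x y := \sum_(j < m) (Phi j x - Phi j y) ^+ 2.
have kdE x y : kdist k x y = kdist k' x y + dPhi x y.
  rewrite /kdist /dPhi !kE.
  have -> : \sum_(j < m) (Phi j x - Phi j y) ^+ 2 =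
      \sum_(j < m) Phi j x * Phi j x - 2 * \sum_(j < m) Phi j x * Phi j y
        + \sum_(j < m) Phi j y * Phi j y.
    rewrite mulr_sumr -sumrB -big_split; apply: eq_bigr => j _ /=; ring.
  by ring.
have dPhi_le x y : dPhi x y <= kdist k x y by rewrite kdE lerDr psd_kdist.
have dPhi_z i j : dPhi (z i) (z j) = kdist k (z i) (z j).
  by rewrite kdE /kdist !zzE; ring.
have Phi1 j x : Phi j x ^+ 2 <= 1.
  apply: le_trans (k1 x); rewrite kE; apply: ler_wpDl; first exact: psd_diag.
  rewrite (bigD1 j)//= -expr2 lerDl; apply: sumr_ge0 => i _.
  by rewrite -expr2 sqr_ge0.
pose T := (Num.truncn (4 * t ^+ 2)).+1.
have T4 : 4 * t ^+ 2 <= T%:R.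
  by rewrite ltW//; exact: truncnS_gt.
have T0 : 0 < T%:R :> R by rewrite ltr0n.
have sT0 : 0 < Num.sqrt T%:R :> R by rewrite sqrtr_gt0.
pose a x (j : 'I_m * 'I_T) := t / Num.sqrt T%:R * Phi j.1 x.
have a2 x j : `|a x j| <= 2^-1.
  rewrite -[leRHS]ger0_norm ?invr_ge0// -ler_sqr ?nnegrE// !real_normK ?num_real//.
  rewrite /a exprMn expr_div_n sqr_sqrtr ?(ltW T0)//.
  apply: (@le_trans _ _ (t ^+ 2 / T%:R)).
    by rewrite ler_piMr ?divr_ge0 ?sqr_ge0 ?(ltW T0)//; exact: Phi1.
  by rewrite ler_pdivrMr//; lra.
have aE x y : sqdist (a x) (a y) = t ^+ 2 * dPhi x y.
  rewrite /sqdist -(pair_big predT predT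
    (fun i (j : 'I_T) => (a x (i, j) - a y (i, j)) ^+ 2)) /= mulr_sumr.
  apply: eq_bigr => j _; rewrite /a /= big_const_ord iter_addr addr0.
  rewrite -mulr_natr -mulrBr exprMn expr_div_n sqr_sqrtr ?(ltW T0)//.
  by field; rewrite gt_eqF.
have [v [v0 v1 vL vT]] := bernoulli_partition z a2.
exists v; split=> //.
- move=> x y; apply: le_trans (vL x y) _; rewrite -mulrA ler_wpM2l//.
  rewrite aE sqrtrM ?sqr_ge0// sqrtr_sqr gtr0_norm// ler_wpM2l ?(ltW t0)//.
  by apply: ler_wsqrtr; exact: dPhi_le.
- move=> x i i0 al be xal xbe albe.
  have d0 := le_trans (dPhi_le x (z i0)) xal.
  have par (w u y : X) : kdist k u y <= 2 * (kdist k u w + kdist k w y).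
    have := kp [:: (1, u); (-2, w); (1, y)]; rewrite !big_cons !big_nil /=.
    rewrite -[in X in _ -> X]subr_ge0 (ks w u) (ks y u) (ks y w).
    by congr (0 <= _); rewrite /kdist; ring.
  have parPhi (w u y : X) : dPhi u y <= 2 * (dPhi u w + dPhi w y).
    rewrite /dPhi -big_split mulr_sumr; apply: ler_sum => j _ /=.
    by have := sqr_ge0 ((Phi j u - Phi j w) - (Phi j w - Phi j y)); nra.
  have dPhiC u w : dPhi u w = dPhi w u.
    by apply: eq_bigr => j _; rewrite -opprB sqrrN.
  have kdC u w : kdist k u w = kdist k w u by rewrite /kdist ks; ring.
  (* [dPhi] ignores the component of x orthogonal to the centres, but is exact between centres.
     Passing through the close centre z i0 and back gives dPhi x (z i) >= be/4 - 3 al/2, and 40 al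
     <= be makes this at least be/5. *)
  have h1 := par (z i0) x (z i).
  have h2 := parPhi x (z i0) (z i); rewrite dPhi_z dPhiC in h2.
  have al0 : 0 <= al by apply: le_trans (psd_kdist _ _ ks kp) xal.
  have h3 : be / 5 <= dPhi x (z i) by lra.
  have t2 : 0 < t ^+ 2 by rewrite exprn_gt0.
  apply: le_trans (vT x i i0 _) _; rewrite !aE.
    by rewrite -mulrA ler_wpM2l ?(ltW t2)//; lra.
  rewrite ler_expR lerN2.
  have : t ^+ 2 * (be / 5) <= t ^+ 2 * dPhi x (z i) by rewrite ler_pM2l.
  by lra.
Qed.

Lemma kernel_partition : (forall x, exists i, kdist k x (z i) <= 256 ^- 2) ->
  exists v : 'I_n.+1 -> X -> R,
  [/\ forall i x, 0 <= v i x,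
      forall x, \sum_i v i x = 1,
      forall i x, 0 < v i x -> kdist k x (z i) <= 256^-1 &
      forall x y, \sum_i `|v i x - v i y| <=
        100 ^+ 2 * Num.sqrt (ln (n.+1.*2%:R)) * Num.sqrt (kdist k x y)].
Proof.
move=> net; set l := ln _; set L := Num.sqrt l.
have N2 : 2 <= n.+1.*2%:R :> R by rewrite ler_nat -addnn addSn addnS.
have l2 : 2^-1 <= l by exact: ln_double_ge.
have l0 : 0 < l by lra.
have LL : L ^+ 2 = l by rewrite sqr_sqrtr// ltW.
have L0 : 0 < L by rewrite sqrtr_gt0.
have L7 : 7 / 10 <= L by rewrite -ler_sqr ?nnegrE ?(ltW L0)//; lra.
(* For this t the net points at distance more than 1/32 from x have weight at
   most 1 / (2 n) each, n being their number, so the others carry half the mass. *)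
have [t tE] : exists t, t = 810 * L by exists (810 * L).
have t0 : 0 < t by rewrite tE; lra.
have [w [w0 w1 wL wT]] := kernel_bernoulli t0.
pose rho x i := Num.sqrt (kdist k x (z i)).
(* The cutoff equals 1 up to distance 1/32 and vanishes from distance 1/16 on, that is, where
   [kdist] is at least 1/256. *)
pose chi x i : R := clamp (2 - 32 * rho x i).
have chi0 x i : 0 <= chi x i by exact: clamp_ge0.
have chi1 x i : chi x i <= 1 by exact: clamp_le1.
have chiL x y i : `|chi x i - chi y i| <= 32 * Num.sqrt (kdist k x y).
  have kdC u v : kdist k u v = kdist k v u by rewrite /kdist ks; ring.
  have h1 := psd_triangle x y (z i) ks kp.
  have h2 := psd_triangle y x (z i) ks kp; rewrite (kdC y x) in h2.
  rewrite -/(rho x i) -/(rho y i) in h1 h2.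
  set r := Num.sqrt _ in h1 h2 *.
  have r0 : 0 <= r by exact: sqrtr_ge0.
  by rewrite (le_trans (clamp_lipschitz _ _))// ler_norml; apply/andP; split; lra.
pose f x i := w i x * chi x i.
have f0 x i : 0 <= f x i by rewrite mulr_ge0.
have fsum x : 2^-1 <= \sum_i f x i.
  have [i0 xi0] := net x.
  have E i : w i x - (n.+1.*2%:R)^-1 <= f x i.
    rewrite /f; have [far|near] := ltP 1024^-1 (kdist k x (z i)).
      apply: (@le_trans _ _ 0); last by rewrite mulr_ge0.
      (* The net radius fits since 40/256^2 <= 1/1024. The exponent is at least l since 810^2 >= 640
         * 1024, which explains the number 810. *)
      rewrite subr_le0; apply: le_trans (wT x i i0 _ 1024^-1 xi0 (ltW far) _) _.
        by lra.
      rewrite -[X in _ <= X^-1]lnK ?posrE ?ltr0n// -expRN ler_expR lerN2 -/l.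
      by rewrite tE exprMn LL; lra.
    have -> : chi x i = 1.
      rewrite /chi /clamp (_ : Num.min _ _ = 1) ?(elimT max_idPr)//.
      apply/min_idPl; suff : rho x i <= 32^-1 by lra.
      rewrite -[leRHS]ger0_norm ?invr_ge0// -sqrtr_sqr; apply: ler_wsqrtr.
      by apply: le_trans near _; lra.
    by rewrite mulr1 gerBl invr_ge0.
  apply: le_trans (ler_sum _ (fun i _ => E i)).
  rewrite sumrB w1 sumr_const card_ord.
  have -> : n.+1.*2%:R^-1 *+ n.+1 = 2^-1 :> R.
    by rewrite -[LHS]mulr_natr -muln2 natrM invfM mulrAC mulVf ?mul1r ?pnatr_eq0.
  by lra.
exists (fun i x => f x i / \sum_j f x j).
have fs0 x : 0 < \sum_i f x i by rewrite (lt_le_trans _ (fsum x)).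
split.
- by move=> i x; rewrite divr_ge0// ltW.
- by move=> x; rewrite -mulr_suml mulfV// gt_eqF.
- move=> i x; rewrite ltNge; apply: contraNT; rewrite -ltNge => far.
  suff -> : f x i = 0 by rewrite mul0r.
  rewrite /f (_ : chi x i = 0) ?mulr0// /chi /clamp; apply/max_idPl.
  rewrite ge_min; apply/orP; right; suff : 16^-1 <= rho x i by lra.
  rewrite -[leLHS]ger0_norm ?invr_ge0// -sqrtr_sqr; apply: ler_wsqrtr.
  by apply: le_trans (ltW far); lra.
- move=> x y; apply: le_trans (normalize_lipschitz _ _ _ (fsum x) (fsum y)) _ => //.
  set r := Num.sqrt _; have r0 : 0 <= r by exact: sqrtr_ge0.
  have : \sum_i `|f x i - f y i| <= 3 * t * r + 32 * r.
    apply: (@le_trans _ _ (\sum_i (`|w i x - w i y| + w i y * (32 * r)))).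
      apply: ler_sum => i _; rewrite /f.
      apply: le_trans (ler_norm_mulB _ _ (chi0 _ _) (w0 _ _)) _; rewrite lerD//.
        by rewrite ler_piMr.
      by rewrite ler_wpM2l.
    by rewrite big_split /= -mulr_suml w1 mul1r lerD// wL.
  (* The constant is 4 (2430 L + 32), and 128 <= 280 L by [L7]. *)
  by rewrite tE; nra.
Qed.

End kernel_partition.
End hilbert_partition.

(** * The Mazur map *)

Section mazur_map.
Context {R : realType}.
Implicit Types (a b p q : R).

(** This is Young's inequality for t and 1 with exponent q and its conjugate; q = 1 is apart, its
    conjugate being infinite. *)
Lemma bernoulli_powR (t q : R) : 0 <= t -> 1 <= q -> 1 + q * (t - 1) <= t `^ q.
Proof.
move=> t0 q1; have [<-|qn1] := eqVneq 1 q.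
  by rewrite powRr1// mul1r; lra.
have q1' : 1 < q by rewrite lt_neqAle qn1.
have q0 : 0 < q by lra.
have c0 : 0 < (1 - q^-1)^-1 by rewrite invr_gt0 subr_gt0 invf_lt1.
have := conjugate_powR t0 ler01 q0 c0; rewrite invrK powR1 mulr1 mul1r.
rewrite addrC subrK => /(_ erefl) h.
have : q * t <= q * (t `^ q / q + (1 - q^-1)) by rewrite ler_pM2l.
rewrite mulrDr [q * (_ / q)]mulrCA mulrBr !mulfV ?gt_eqF//; lra.
Qed.

(** Convexity by the tangent at the mean m of |a| and |b|: Bernoulli's inequality is applied to
    |a|/m and |b|/m, whose linear terms cancel. *)
Lemma powR_midpoint (p a b : R) : 1 <= p ->
  `|(a - b) / 2| `^ p <= (`|a| `^ p + `|b| `^ p) / 2.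
Proof.
move=> p1; have p0 : 0 < p by lra.
set m := (`|a| + `|b|) / 2.
have m0 : 0 <= m by rewrite divr_ge0// addr_ge0.
have abm : `|(a - b) / 2| <= m.
  by rewrite normrM normfV (ger0_norm (ler0n R 2)) ler_wpM2r ?invr_ge0// ler_normB.
have := ge0_ler_powR (ltW p0) _ _ abm; rewrite !nnegrE => /(_ (normr_ge0 _) m0).
move=> /le_trans; apply.
have [->|mn0] := eqVneq m 0.
  by rewrite powR0 ?gt_eqF// divr_ge0// addr_ge0// powR_ge0.
have mp : 0 < m by rewrite lt0r mn0.
have mpp : 0 < m `^ p by exact: powR_gt0.
have scale (c : R) : m `^ p * (`|c| / m) `^ p = `|c| `^ p.
  by rewrite -powRM ?divr_ge0// mulrC divfK.
rewrite -(scale a) -(scale b).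
have ha := bernoulli_powR (divr_ge0 (normr_ge0 a) m0) p1.
have hb := bernoulli_powR (divr_ge0 (normr_ge0 b) m0) p1.
have hab : `|a| / m + `|b| / m = 2 by rewrite /m; field; move: mn0; rewrite /m; lra.
have : 2 <= (`|a| / m) `^ p + (`|b| / m) `^ p by nra.
by nra.
Qed.

Definition mazur q a : R := Num.sg a * `|a| `^ q.

Lemma mazurN q a : mazur q (- a) = - mazur q a.
Proof. by rewrite /mazur sgrN normrN mulNr. Qed.

Lemma mazur0 q : mazur q 0 = 0.
Proof. by rewrite /mazur sgr0 mul0r. Qed.

Lemma mazur_ge0 q a : 0 <= a -> mazur q a = if a == 0 then 0 else a `^ q.
Proof.
rewrite le_eqVlt => /predU1P[<-|a0]; first by rewrite eqxx mazur0.
by rewrite gt_eqF// /mazur gtr0_sg// mul1r gtr0_norm.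
Qed.

Lemma mazurM q a b : mazur q (a * b) = mazur q a * mazur q b.
Proof. by rewrite /mazur sgrM normrM powRM//; ring. Qed.

Lemma normr_mazur q a : 0 < q -> `|mazur q a| = `|a| `^ q.
Proof.
move=> q0; have [->|an0] := eqVneq a 0.
  by rewrite mazur0 !normr0 powR0// gt_eqF.
by rewrite /mazur normrM normr_sg an0 mul1r ger0_norm// powR_ge0.
Qed.

(** By homogeneity the larger argument becomes 1 and the other one u with |u| <= 1. Bernoulli's
    inequality settles u >= 0, and |u|^q <= |u| settles u < 0. *)
Lemma mazur_lipschitz q a b : 1 <= q ->
  `|mazur q a - mazur q b| <= q * `|a - b| * Num.max `|a| `|b| `^ (q - 1).
Proof.
move=> q1; have q0 : 0 < q by lra.
wlog ba : a b / `|b| <= `|a|.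
  move=> W; have [/W//|/W] := orP (le_total `|b| `|a|).
  by rewrite distrC [`|b - a|]distrC maxC.
rewrite (max_idPl ba).
have [a0|an0] := eqVneq a 0.
  move: ba; rewrite a0 normr0 normr_le0 => /eqP ->.
  by rewrite !subrr normr0 mulr0 mul0r.
pose u := b / a; have bE : b = a * u by rewrite /u mulrC divfK.
have u1 : `|u| <= 1 by rewrite normrM normfV ler_pdivrMr ?normr_gt0// mul1r.
have -> : a - b = a * (1 - u) by rewrite bE; ring.
have -> : mazur q a - mazur q b = mazur q a * (1 - mazur q u).
  by rewrite bE mazurM; ring.
rewrite normrM normr_mazur// normrM.
have -> : `|a| `^ q = `|a| * `|a| `^ (q - 1).
  by rewrite mulr_powRB1.
rewrite [leRHS](_ : _ = `|a| * `|a| `^ (q - 1) * (q * `|1 - u|)); last by ring.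
rewrite ler_wpM2l ?mulr_ge0 ?powR_ge0//.
have [u0|u0] := leP 0 u.
  move: u1; rewrite (ger0_norm u0) => u1.
  rewrite [leRHS](_ : _ = q * (1 - u)); last by rewrite ger0_norm// subr_ge0.
  have uq1 : u `^ q <= 1.
    have := ge0_ler_powR (ltW q0) (x := u) (y := 1); rewrite !nnegrE powR1.
    by apply.
  rewrite mazur_ge0//; case: eqP => [->|_].
    by rewrite subr0 normr1; lra.
  have := bernoulli_powR u0 q1.
  by rewrite ger0_norm ?subr_ge0//; lra.
rewrite -[u]opprK mazurN !opprK; move: u1; rewrite (ltr0_norm u0) => u1.
have Nu0 : 0 <= - u by lra.
have uq1 : (- u) `^ q <= - u by rewrite ge1r_powR// u1 oppr_gt0 u0.
rewrite mazur_ge0// oppr_eq0 lt_eqF// !ger0_norm ?addr_ge0 ?powR_ge0//.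
by nra.
Qed.

Lemma mazur_sqr p a : 2 <= p -> mazur (p / 2) a ^+ 2 = `|a| `^ p.
Proof.
move=> p2; rewrite -real_normK ?num_real// normr_mazur; last by lra.
by rewrite -powR_mulrn ?powR_ge0// -powRrM; congr powR; lra.
Qed.

(* Young's inequality replaces Hoelder's: the bound is integrated termwise. *)
Lemma mazur_sqr_lipschitz p a b (d : R) : 2 <= p -> 0 < d ->
  (mazur (p / 2) a - mazur (p / 2) b) ^+ 2 <= (p / 2) ^+ 2 * d ^+ 2 *
    (2 / p * `|(a - b) / d| `^ p + (1 - 2 / p) * (`|a| `^ p + `|b| `^ p)).
Proof.
move=> p2 d0; have p0 : 0 < p by lra.
set m := Num.max `|a| `|b|; have m0 : 0 <= m by rewrite le_max normr_ge0.
have mp : m `^ p <= `|a| `^ p + `|b| `^ p.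
  by rewrite /m /Num.max; case: ifP => _; rewrite ?lerDl ?lerDr powR_ge0.
have q1 : 1 <= p / 2 by lra.
have mL := mazur_lipschitz a b q1; rewrite -/m in mL.
have Y : ((a - b) / d) ^+ 2 * (m `^ (p / 2 - 1)) ^+ 2 <=
    2 / p * `|(a - b) / d| `^ p + (1 - 2 / p) * m `^ p.
  rewrite -[X in X ^+ 2 * _]/((a - b) / d) -real_normK ?num_real//.
  set u := `|_|; have u0 : 0 <= u by exact: normr_ge0.
  (* The exponents are p/2 and 1/(1 - 2/p); the latter is infinite at p = 2. *)
  have [pE|pn2] := eqVneq p 2.
    rewrite pE divff// subrr mul0r powRr0 addr0 expr1n mulr1 mul1r.
    by rewrite powR_mulrn.
  have p2' : 2 < p by rewrite lt_neqAle eq_sym pn2.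
  have c0 : 0 < (1 - 2 / p)^-1 by rewrite invr_gt0 subr_gt0 ltr_pdivrMr// mul1r.
  have h0 : 0 < p / 2 by lra.
  have := conjugate_powR (sqr_ge0 u) (sqr_ge0 (m `^ (p / 2 - 1))) h0 c0.
  rewrite invrK invf_div addrC subrK => /(_ erefl) /le_trans; apply.
  rewrite -powR_mulrn// -powRrM -[in leLHS]powR_mulrn ?powR_ge0// -!powRrM.
  have -> : 2 * (p / 2) = p by field.
  have -> : (p / 2 - 1) * (2 * (1 - 2 / p)^-1) = p.
    field; rewrite gt_eqF//= -[_ - _]/(p - 2).
    by rewrite subr_eq0.
  by rewrite (mulrC (u `^ p)) (mulrC (m `^ p)).
have p21 : 2 / p <= 1 by rewrite ler_pdivrMr// mul1r.
apply: (@le_trans _ _ ((p / 2) ^+ 2 * d ^+ 2 *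
    (((a - b) / d) ^+ 2 * (m `^ (p / 2 - 1)) ^+ 2))); last first.
  apply: ler_wpM2l; first exact: mulr_ge0 (sqr_ge0 _) (sqr_ge0 _).
  apply: le_trans Y _.
  by rewrite lerD2l ler_wpM2l// subr_ge0.
rewrite -real_normK ?num_real// [leRHS](_ : _ =
  (p / 2 * `|a - b| * m `^ (p / 2 - 1)) ^+ 2).
  by rewrite lerXn2r ?nnegrE// !mulr_ge0 ?powR_ge0//; lra.
by rewrite !exprMn real_normK ?num_real//; field; rewrite gt_eqF.
Qed.

Lemma powR1D_le p (x : R) : 0 <= p -> 0 <= 1 + x -> (1 + x) `^ p <= expR (x * p).
Proof.
move=> p0 x0; rewrite expRM ge0_ler_powR ?nnegrE ?expR_ge0//.
exact: expR_ge1Dx.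
Qed.

(* Where M a and M b are close relative to M a, the number b / p has the sign of
   a and is comparable with a / p, so that subtracting it shrinks a; elsewhere
   both |a| and |b| are controlled by |M a - M b|. *)
Lemma mazur_shrink p a b : 2 <= p ->
  `|(1 + (6 * p)^-1) * (a - p^-1 * b)| `^ p <=
    4 / 5 * `|a| `^ p + 44 * (mazur (p / 2) a - mazur (p / 2) b) ^+ 2.
Proof.
move=> p2; have p0 : 0 < p by lra.
set q := p / 2; have q1 : 1 <= q by rewrite /q; lra.
have q0 : 0 < q by lra.
have pV : 0 < p^-1 by rewrite invr_gt0.
have pV2 : p^-1 <= 2^-1 by rewrite lef_pV2 ?posrE.
have K0 : 0 <= 1 + (6 * p)^-1 by rewrite addr_ge0// invr_ge0 mulr_ge0// ltW.
rewrite normrM (ger0_norm K0) powRM//.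
have Kp : (1 + (6 * p)^-1) `^ p <= 6 / 5.
  apply: le_trans (powR1D_le (ltW p0) K0) _.
  have -> : (6 * p)^-1 * p = 6^-1 by field; rewrite gt_eqF.
  apply: le_trans (expR_le_inv _) _; first by lra.
  by rewrite (_ : (1 - 6^-1)^-1 = 6 / 5)//; field.
have S1 : (1 - p^-1 / 2) `^ p <= 2 / 3.
  apply: le_trans (powR1D_le (ltW p0) _) _; first by lra.
  have -> : - (p^-1 / 2) * p = - 2^-1 by field; rewrite gt_eqF.
  rewrite expRN -[leRHS]invrK lef_pV2 ?posrE ?expR_gt0 ?invf_div//.
  by apply: le_trans (expR_ge1Dx _); lra.
have S2 : (1 + p^-1) `^ p <= 4.
  apply: le_trans (powR1D_le (ltW p0) _) _; first by lra.
  rewrite mulVf ?gt_eqF// (_ : 1 = 2^-1 + 2^-1) ?expRD; last by lra.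
  have : expR 2^-1 <= 2 :> R.
    apply: le_trans (expR_le_inv _) _; first by lra.
    by rewrite (_ : (1 - 2^-1)^-1 = 2)//; field.
  by have := expR_ge0 (2^-1 : R); nra.
set A := mazur q a; set B := mazur q b.
have ap0 := powR_ge0 `|a| p.
(* The factor [Kp] turns 2/3 into 4/5 and 36 into 43.2, below 44. *)
suff H : `|a - p^-1 * b| `^ p <= 2 / 3 * `|a| `^ p + 36 * (A - B) ^+ 2.
  have h0 := powR_ge0 `|a - p^-1 * b| p; have h1 := sqr_ge0 (A - B).
  apply: (@le_trans _ _ (6 / 5 * (2 / 3 * `|a| `^ p + 36 * (A - B) ^+ 2))).
    by apply: ler_pM => //; exact: powR_ge0.
  by lra.
have ASq : A ^+ 2 = `|a| `^ p by exact: mazur_sqr.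
have BSq : B ^+ 2 = `|b| `^ p by exact: mazur_sqr.
have [close|far] := leP `|A - B| (`|A| / 2); last first.
  set m := Num.max `|a| `|b|; have m0 : 0 <= m by rewrite le_max normr_ge0.
  (* Here |A| <= 2 |A - B| and hence |B| <= 3 |A - B|; the square of 3 is the 9, and [S2] later
     multiplies it by 4. *)
  have mp : m `^ p <= 9 * (A - B) ^+ 2.
    have hB : `|B| <= `|A| + `|A - B|.
      by rewrite -[B in leLHS](subKr A) (le_trans (ler_normB _ _)).
    have := normr_ge0 A; have := normr_ge0 B; have := normr_ge0 (A - B).
    rewrite /m /Num.max; case: ifP => _ h1 h2 h3; rewrite -?ASq -?BSq.
      by rewrite -(real_normK (num_real B)) -(real_normK (num_real (A - B))); nra.
    by rewrite -(real_normK (num_real A)) -(real_normK (num_real (A - B))); nra.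
  have am : `|a| <= m by rewrite le_max lexx.
  have bm : `|b| <= m by rewrite le_max lexx orbT.
  have : `|a - p^-1 * b| <= m * (1 + p^-1).
    apply: le_trans (ler_normB _ _) _; rewrite normrM (gtr0_norm pV) mulrDr mulr1.
    by rewrite lerD// mulrC ler_wpM2r// ltW.
  move=> /(ge0_ler_powR (ltW p0)); rewrite !nnegrE mulr_ge0//; last by lra.
  move=> /(_ (normr_ge0 _) isT); rewrite powRM//; last by lra.
  move=> /le_trans; apply.
  apply: (@le_trans _ _ (9 * (A - B) ^+ 2 * 4)).
    by apply: ler_pM => //; exact: powR_ge0.
  by lra.
(* It will follow that b lies between a/2 and 3a/2 (for a > 0), so a - b/p is nonnegative and at
   most a (1 - 1/(2p)); [S1] then bounds the p-th power of the factor by 2/3. *)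
suff : `|a - p^-1 * b| <= `|a| * (1 - p^-1 / 2).
  move=> /(ge0_ler_powR (ltW p0)); rewrite !nnegrE mulr_ge0//; last by lra.
  move=> /(_ (normr_ge0 _) isT); rewrite powRM//; last by lra.
  move=> /le_trans; apply; have := sqr_ge0 (A - B); nra.
wlog a0 : a b @A @B ap0 ASq BSq close / 0 <= a.
  move=> W; have [/W//|a0] := leP 0 a; first by apply.
  rewrite -(opprK a) normrN -(normrN (_ - _)) -(opprK b).
  have -> : - (- - a - p^-1 * - - b) = - a - p^-1 * - b by ring.
  apply: W; rewrite ?mazurN ?normrN ?sqrrN//; last by rewrite oppr_ge0 ltW.
  by rewrite -opprD normrN.
have [a00|an0] := eqVneq a 0.
  move: close; rewrite /A /B a00 mazur0 sub0r !normr0 mul0r normrN normr_mazur//.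
  move=> h; have : `|b| `^ q == 0 by rewrite eq_le h powR_ge0.
  by rewrite powR_eq0 => /andP[/eqP/normr0_eq0 -> _]; rewrite mulr0 subr0 normr0 mul0r.
have ap : 0 < a by rewrite lt0r an0.
have AE : A = a `^ q by rewrite /A mazur_ge0// (negPf an0).
have Ap : 0 < A by rewrite AE powR_gt0.
move: close; rewrite (gtr0_norm Ap) ler_norml => /andP[c1 c2].
have b0 : 0 < b.
  rewrite ltNge; apply/negP => b0; suff : B <= 0 by lra.
  by rewrite /B -[b]opprK mazurN oppr_le0 /mazur mulr_ge0 ?powR_ge0// sgr_ge0 oppr_ge0.
have BE : B = b `^ q by rewrite /B mazur_ge0 ?(ltW b0)// gt_eqF.
have b1 : a / 2 <= b.
  rewrite leNgt; apply/negP => ba; suff : B < A / 2 by lra.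
  rewrite BE; apply: (@lt_le_trans _ _ ((a / 2) `^ q)).
    by apply: gt0_ltr_powR; rewrite // nnegrE; lra.
  rewrite powRM ?(ltW ap)// -AE ler_pM2l//.
  by rewrite ge1r_powR//; lra.
have b2 : b <= 3 / 2 * a.
  rewrite leNgt; apply/negP => ba; suff : 3 / 2 * A < B by lra.
  rewrite BE; apply: (@le_lt_trans _ _ ((3 / 2 * a) `^ q)); last first.
    by apply: gt0_ltr_powR; rewrite // nnegrE; lra.
  rewrite powRM ?(ltW ap)//.
  rewrite -AE ler_pM2r// -[leLHS]powRr1; last by lra.
  by rewrite ler_powR//; lra.
rewrite (ger0_norm a0) ger0_norm; nra.
Qed.

End mazur_map.

(** * Local partitions of the unit ball of L_p through the Mazur map *)

Section Lp_local_partition.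
Context {d} {T : measurableType d} {R : realType}.
Variables (mu : {measure set T -> \bar R}) (p : R).
Hypothesis p2 : 2 <= p.
Implicit Types (f g : T -> R).

Let p0 : 0 < p. Proof. by apply: lt_le_trans p2. Qed.

(** The closed unit ball, stated for functions rather than classes so that it applies directly to
    recentred and rescaled functions. *)
Definition Lp_unit f := measurable_fun [set: T] f /\
  (\int[mu]_t (`|f t| `^ p)%:E <= 1)%E.

Let mpow f : measurable_fun [set: T] f ->
  measurable_fun [set: T] (fun t => `|f t| `^ p).
Proof.
move=> mf; apply: (measurableT_comp (measurable_powR p)) => //.
exact: measurableT_comp.
Qed.

Let ipow f : Lp_unit f -> mu.-integrable [set: T] (EFin \o (fun t => `|f t| `^ p)).
Proof.
move=> [mf f1]; apply/integrableP; split; first exact/measurable_EFinP/mpow.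
under eq_integral => t _ do rewrite /= ger0_norm ?powR_ge0//.
exact: le_lt_trans f1 (ltry _).
Qed.

Let Ipow f : Lp_unit f -> \int[mu]_t (`|f t| `^ p) <= 1.
Proof.
move=> uf; rewrite -lee_fin /Rintegral fineK; first by case: uf.
by apply: integrable_fin_num => //; exact: ipow.
Qed.

Let M := mazur (p / 2).

Let mazur_measurable f : measurable_fun [set: T] f ->
  measurable_fun [set: T] (fun t => M (f t)).
Proof.
move=> mf.
(* The powers of the positive and negative parts are measurable, which avoids the sign function. *)
have -> : (fun t => M (f t)) =
    (fun t => Num.max (f t) 0 `^ (p / 2) - Num.max (- f t) 0 `^ (p / 2)).
  apply/funext => t; rewrite /M /mazur; have q0 : p / 2 != 0.
    by rewrite mulf_neq0// gt_eqF.
  case: (sgrP (f t)) => [->|ft|ft]; rewrite ?mul0r ?mul1r ?mulN1r.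
  - by rewrite oppr0 maxxx subrr.
  - rewrite (max_idPl (ltW ft)) (elimT max_idPr) ?oppr_le0 ?(ltW ft)//.
    by rewrite powR0// subr0.
  - rewrite (max_idPr (ltW ft)) (elimT max_idPl) ?oppr_ge0 ?(ltW ft)//.
    by rewrite powR0// sub0r.
apply: measurable_funB; apply: (measurableT_comp (measurable_powR _)) => //.
  exact: measurable_maxr.
by apply: measurable_maxr => //; exact: measurableT_comp.
Qed.

Lemma Lp_unit_mul f g : Lp_unit f -> Lp_unit g ->
  mu.-integrable [set: T] (EFin \o (fun t => M (f t) * M (g t))).
Proof.
move=> uf ug.
apply: (le_integrable _ _ _ (integrableD _ (ipow uf) (ipow ug))) => //.
  apply/measurable_EFinP; apply: measurable_funM; apply: mazur_measurable.
    by case: uf.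
  by case: ug.
move=> t _ /=; rewrite lee_fin normrM -!mazur_sqr// [leRHS]ger0_norm.
  rewrite -(real_normK (num_real (mazur _ (f t)))).
  rewrite -(real_normK (num_real (mazur _ (g t)))).
  by have := sqr_ge0 (`|M (f t)| - `|M (g t)|);
    have := sqr_ge0 (`|M (f t)| + `|M (g t)|); rewrite /M; nra.
by rewrite addr_ge0 ?sqr_ge0.
Qed.

Lemma Rintegral_sum (I : Type) (s : seq I) (h : I -> T -> R) :
  (forall i, mu.-integrable [set: T] (EFin \o h i)) ->
  mu.-integrable [set: T] (EFin \o (fun t => \sum_(i <- s) h i t)) /\
  \int[mu]_t (\sum_(i <- s) h i t) = \sum_(i <- s) \int[mu]_t h i t.
Proof.
move=> ih; elim: s => [|i s [IH1 IH2]].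
  under eq_fun do rewrite big_nil; rewrite big_nil; split.
    exact: integrable0.
  by rewrite Rintegral_cst// mul0r.
under eq_fun do rewrite big_cons; rewrite big_cons; split.
  exact: (integrableD measurableT (ih i) IH1).
by rewrite RintegralD// IH2.
Qed.

Section partition.
Context {X : Type} (u : X -> T -> R).
Hypothesis uu : forall x, Lp_unit (u x).

Definition mazur_kernel x y := \int[mu]_t (M (u x t) * M (u y t)).

Local Notation k := mazur_kernel.

Lemma mazur_kernelC x y : k x y = k y x.
Proof. by apply: eq_Rintegral => t _; rewrite mulrC. Qed.

(** The quadratic form is the integral of the square of a linear combination of the Mazur images. *)
Lemma mazur_kernel_psd : psd k.
Proof.
move=> s.
have E1 (a b : R * X) : a.1 * b.1 * k a.2 b.2 =
    \int[mu]_t (a.1 * b.1 * (M (u a.2 t) * M (u b.2 t))).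
  by rewrite RintegralZl//; exact: Lp_unit_mul.
have I1 (a b : R * X) : mu.-integrable [set: T]
    (EFin \o (fun t => a.1 * b.1 * (M (u a.2 t) * M (u b.2 t)))).
  exact: (integrableZl measurableT _ (Lp_unit_mul (uu a.2) (uu b.2))).
under eq_bigr => a _.
  under eq_bigr => b _ do rewrite E1.
  rewrite -(proj2 (Rintegral_sum s (I1 a))).
  over.
rewrite -(proj2 (Rintegral_sum s (fun a => proj1 (Rintegral_sum s (I1 a))))).
apply: Rintegral_ge0 => t _.
have -> : \sum_(a <- s) \sum_(b <- s) a.1 * b.1 * (M (u a.2 t) * M (u b.2 t)) =
    (\sum_(a <- s) a.1 * M (u a.2 t)) ^+ 2.
  rewrite expr2 mulr_suml; apply: eq_bigr => a _; rewrite mulr_sumr.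
  by apply: eq_bigr => b _; ring.
exact: sqr_ge0.
Qed.

Lemma mazur_kernel_diag x : k x x <= 1.
Proof.
apply: le_trans (Ipow (uu x)); rewrite le_eqVlt; apply/orP; left; apply/eqP.
by apply: eq_Rintegral => t _; rewrite -expr2 mazur_sqr.
Qed.

Lemma mazur_kdist x y :
  mu.-integrable [set: T] (EFin \o (fun t => (M (u x t) - M (u y t)) ^+ 2)) /\
  kdist k x y = \int[mu]_t (M (u x t) - M (u y t)) ^+ 2.
Proof.
have Ix a b := Lp_unit_mul (uu a) (uu b).
have I2 := integrableZl measurableT (-2) (Ix x y).
have I12 := integrableD measurableT (Ix x x) I2.
have E : (fun t => (M (u x t) - M (u y t)) ^+ 2) = (fun t =>
    M (u x t) * M (u x t) + (- 2) * (M (u x t) * M (u y t))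
    + M (u y t) * M (u y t)) by apply/funext => t; ring.
rewrite E; split; first exact: (integrableD measurableT I12 (Ix y y)).
rewrite (RintegralD measurableT I12 (Ix y y)) (RintegralD measurableT (Ix x x) I2).
by rewrite (RintegralZl _ measurableT (Ix x y)) /kdist mulNr.
Qed.

Lemma mazur_kdist_le x y (e : R) : 0 < e -> Lp_unit (fun t => (u x t - u y t) / e) ->
  kdist k x y <= p ^+ 2 * e ^+ 2.
Proof.
move=> e0 ue; have [i1 ->] := mazur_kdist x y.
have p21 : 2 / p <= 1 by rewrite ler_pdivrMr// mul1r.
have p20 : 0 <= 2 / p by rewrite divr_ge0// ltW.
have i2 := integrableZl measurableT (2 / p) (ipow ue).
have i3 := integrableD measurableT (ipow (uu x)) (ipow (uu y)).
have i4 := integrableZl measurableT (1 - 2 / p) i3.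
have i5 := integrableD measurableT i2 i4.
have i6 := integrableZl measurableT ((p / 2) ^+ 2 * e ^+ 2) i5.
apply: (le_trans (le_Rintegral measurableT i1 i6 _)).
  by move=> t _; exact: mazur_sqr_lipschitz.
rewrite (RintegralZl _ measurableT i5) (RintegralD measurableT i2 i4).
rewrite (RintegralZl _ measurableT (ipow ue)) (RintegralZl _ measurableT i3).
rewrite (RintegralD measurableT (ipow (uu x)) (ipow (uu y))).
have := Ipow ue; have := Ipow (uu x); have := Ipow (uu y).
set A := Rintegral _ _ _; set B := Rintegral _ _ _; set C := Rintegral _ _ _.
move=> A1 B1 C1.
(* The integrated bracket is at most 1 + 2, hence below 4. *)
have -> : p ^+ 2 * e ^+ 2 = (p / 2) ^+ 2 * e ^+ 2 * 4 by field.
apply: ler_wpM2l; first exact: mulr_ge0 (sqr_ge0 _) (sqr_ge0 _).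
have : 2 / p * C <= 1.
  by rewrite -[leRHS]mulr1 ler_pM// /C Rintegral_ge0.
have : (1 - 2 / p) * (B + A) <= 1 * 2.
  rewrite ler_pM ?subr_ge0//; [|by rewrite gerBl|lra].
  by rewrite /A /B addr_ge0// Rintegral_ge0// => t _; exact: powR_ge0.
by lra.
Qed.

(** Integrating [mazur_shrink] gives at most 4/5 + 44/256 < 1; this fixes the support radius
    1/256. *)
Lemma mazur_kdist_shrink x y : kdist k x y <= 256^-1 ->
  Lp_unit (fun t => (1 + (6 * p)^-1) * (u x t - p^-1 * u y t)).
Proof.
have [i1 ->] := mazur_kdist x y => h.
have mx := proj1 (uu x); have my := proj1 (uu y).
have mf : measurable_fun [set: T]
    (fun t => (1 + (6 * p)^-1) * (u x t - p^-1 * u y t)).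
  by do ?[exact: measurable_cst|apply: measurable_funM|apply: measurable_funB].
split=> //.
have i2 := integrableZl measurableT (4 / 5) (ipow (uu x)).
have i3 := integrableZl measurableT 44 i1.
have i4 := integrableD measurableT i2 i3.
apply: (@le_trans _ _ (\int[mu]_t
    (4 / 5 * `|u x t| `^ p + 44 * (M (u x t) - M (u y t)) ^+ 2)%:E)%E).
  apply: ge0_le_integral => //.
  - exact/measurable_EFinP/mpow.
  - exact: measurable_int i4.
  - by move=> t _; rewrite lee_fin; exact: mazur_shrink.
rewrite -[leLHS]fineK; last by apply: integrable_fin_num => //.
rewrite lee_fin -/(Rintegral _ _ _) (RintegralD measurableT i2 i3).
rewrite (RintegralZl _ measurableT (ipow (uu x))) (RintegralZl _ measurableT i1).
have := Ipow (uu x); lra.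
Qed.

(** [D] plays the role of the L_p distance of the functions u. A net at distance 1/(256 p) has Mazur
    images forming a net with [kdist] at most 256^-2, as [kernel_partition] asks. *)
Lemma Lp_local_partition (n : nat) (z : 'I_n.+1 -> X) (D : X -> X -> R) :
  (forall x y, 0 <= D x y) ->
  (forall x y (e : R), 0 < e -> D x y <= e -> Lp_unit (fun t => (u x t - u y t) / e)) ->
  (forall x, exists i, D x (z i) <= (256 * p)^-1) ->
  exists v : 'I_n.+1 -> X -> R,
  [/\ forall i x, 0 <= v i x,
      forall x, \sum_i v i x = 1,
      forall i x, 0 < v i x ->
        Lp_unit (fun t => (1 + (6 * p)^-1) * (u x t - p^-1 * u (z i) t)) &
      forall x y, \sum_i `|v i x - v i y| <=
        100 ^+ 2 * Num.sqrt (ln (n.+1.*2%:R)) * p * D x y].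
Proof.
move=> D0 De net.
have [|v [v0 v1 vS vL]] := @kernel_partition _ X k n z mazur_kernelC
    mazur_kernel_psd mazur_kernel_diag.
  move=> x; have [i xi] := net x; exists i.
  have e0 : 0 < (256 * p)^-1 :> R by rewrite invr_gt0 (pmulr_lgt0 _ p0) ltr0n.
  apply: le_trans (mazur_kdist_le e0 (De _ _ _ e0 xi)) _.
  rewrite le_eqVlt; apply/orP; left; apply/eqP.
  by field; rewrite gt_eqF.
exists v; split=> // [i x vix|x y].
  by apply: mazur_kdist_shrink; exact: vS.
apply: le_trans (vL x y) _; rewrite -[leRHS]mulrA ler_wpM2l//.
(* D x y may be 0 whereas [mazur_kdist_le] needs a positive bound, so it is applied to D x y + e for
   every e > 0. *)
rewrite -ler_pdivrMl//; apply/ler_addgt0Pr => e e0.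
have De0 : 0 < D x y + e by rewrite ltr_wpDl.
have := mazur_kdist_le De0 (De x y _ De0 _); rewrite lerDl => /(_ (ltW e0)) h.
rewrite ler_pdivrMl//.
rewrite -[leRHS]ger0_norm; last by rewrite mulr_ge0 ?(ltW p0) ?(ltW De0).
by rewrite -sqrtr_sqr exprMn; exact: ler_wsqrtr.
Qed.

End partition.
End Lp_local_partition.

(** * Lipschitz partitions of unity in doubling spaces *)

Section systems.
Context {R : realType} {M : metricType R}.
Implicit Types (adm : set (set M)) (r s : R).

(* A Lipschitz partition of unity on M at scale r with finitely many colours;
   the pieces of a given colour are told apart by the labels lab. *)
Definition system adm r s := exists (Q : finType) (w : Q -> M -> R)
    (lab : Q -> M -> nat),
  [/\ forall q x, 0 <= w q x,
      forall x, \sum_q w q x = 1,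
      forall q l, adm [set x | 0 < w q x /\ lab q x = l] &
      forall x y, mdist x y < r ->
        (forall q, 0 < w q x -> 0 < w q y -> lab q x = lab q y) /\
        \sum_q `|w q x - w q y| <= s / r * mdist x y].

Lemma system_monotone adm1 adm2 r s1 s2 : 0 < r -> s1 <= s2 ->
  adm1 `<=` adm2 -> system adm1 r s1 -> system adm2 r s2.
Proof.
move=> r0 s12 a12 [Q [w [lab [w0 w1 wA wL]]]]; exists Q, w, lab.
split=> // [q l|x y xy]; first exact/a12/wA.
have [h1 h2] := wL x y xy; split=> //; apply: le_trans h2 _.
by rewrite ler_wpM2r ?mdist_ge0// ler_wpM2r// invr_ge0 ltW.
Qed.

(** The new weights are products of a coarse weight and a fine weight chosen by colour and label. In
    the product rule, the variation of the coarse weights contributes s/K and that of the fine ones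
    A; labels are inherited from the coarse colour. *)
Lemma system_refine adm1 adm2 r K s A n : 0 < r -> 1 <= K -> 0 <= A ->
  system adm1 (K * r) s ->
  (forall S, adm1 S -> exists v : 'I_n -> M -> R,
    [/\ forall i x, 0 <= v i x,
        forall x, S x -> \sum_i v i x = 1,
        forall i, adm2 [set x | S x /\ 0 < v i x] &
        forall x y, S x -> S y ->
          \sum_i `|v i x - v i y| <= A / r * mdist x y]) ->
  system adm2 r (s / K + A).
Proof.
move=> r0 K1 A0 [Q [w [lab [w0 w1 wA wL]]]] fine.
have /choice[v vP] : forall ql : Q * nat, exists v : 'I_n -> M -> R,
    let S := [set x | 0 < w ql.1 x /\ lab ql.1 x = ql.2] in
    [/\ forall i x, 0 <= v i x,
        forall x, S x -> \sum_i v i x = 1,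
        forall i, adm2 [set x | S x /\ 0 < v i x] &
        forall x y, S x -> S y ->
          \sum_i `|v i x - v i y| <= A / r * mdist x y].
  by move=> [q l]; apply: fine; exact: wA.
have K0 : 0 < K by rewrite (lt_le_trans _ K1).
exists (Q * 'I_n)%type.
exists (fun qi x => w qi.1 x * v (qi.1, lab qi.1 x) qi.2 x).
exists (fun qi => lab qi.1).
have v0 ql i x : 0 <= v ql i x by case: (vP ql).
have sumv q x : 0 < w q x -> \sum_i v (q, lab q x) i x = 1.
  by move=> wq; case: (vP (q, lab q x)) => _ + _ _; apply.
have sumwv q x : \sum_i w q x * v (q, lab q x) i x = w q x.
  rewrite -mulr_sumr; have := w0 q x; rewrite le_eqVlt => /predU1P[<-|wq].
    by rewrite mul0r.
  by rewrite sumv ?mulr1.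
have sum_pairE (F : Q * 'I_n -> R) :
    \sum_qi F qi = \sum_q \sum_i F (q, i).
  by rewrite pair_bigA; apply: eq_bigr => -[].
split.
- by move=> [q i] x; rewrite mulr_ge0.
- by move=> x; rewrite sum_pairE /= -(w1 x); apply: eq_bigr => q _; exact: sumwv.
- move=> [q i] l /=; have [_ _ /(_ i) + _] := vP (q, l).
  congr adm2; apply/seteqP; split=> x /=.
    by move=> [[wx <-] vx]; split=> //; rewrite mulr_gt0.
  move=> [wv lx]; have wx : 0 < w q x.
    by rewrite lt0r w0 andbT; apply: contraTneq wv => ->; rewrite mul0r ltxx.
  by split=> //; move: wv; rewrite lx pmulr_rgt0.
- move=> x y xy.
  have [|lE wxy] := wL x y.
    by rewrite (lt_le_trans xy)// ler_peMl// ltW.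
  have wpos q i z : 0 < w q z * v (q, lab q z) i z -> 0 < w q z.
    by move=> wv; rewrite lt0r w0 andbT; apply: contraTneq wv => ->;
      rewrite mul0r ltxx.
  split=> [[q i] /= /wpos wx /wpos wy|]; first exact: lE.
  have dA : 0 <= A / r * mdist x y.
    by rewrite mulr_ge0 ?mdist_ge0// divr_ge0// ltW.
  rewrite sum_pairE /=.
  apply: (@le_trans _ _ (\sum_q (`|w q x - w q y| + w q y * (A / r * mdist x y)))).
    apply: ler_sum => q _.
    (* If a coarse weight vanishes at x or y, the labels there may differ and the fine weights
       belong to different families; they are then summed to 1 instead of compared. *)
    have := w0 q y; rewrite le_eqVlt => /predU1P[wy0|wy].
      rewrite -wy0 mul0r addr0 subr0 ger0_norm//.
      under eq_bigr => i _ do rewrite mul0r subr0 ger0_norm ?mulr_ge0//.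
      by rewrite sumwv.
    have := w0 q x; rewrite le_eqVlt => /predU1P[wx0|wx].
      rewrite -wx0 sub0r normrN ger0_norm//.
      under eq_bigr => i _ do rewrite mul0r sub0r normrN ger0_norm ?mulr_ge0//.
      by rewrite sumwv lerDl mulr_ge0.
    rewrite -(lE q wx wy).
    apply: (@le_trans _ _ (\sum_i (`|w q x - w q y| * v (q, lab q x) i x +
        w q y * `|v (q, lab q x) i x - v (q, lab q x) i y|))).
      by apply: ler_sum => i _; exact: ler_norm_mulB.
    rewrite big_split /= -!mulr_sumr sumv// mulr1 lerD2l ler_wpM2l//.
    have [_ _ _] := vP (q, lab q x); apply=> //=; split=> //.
    by rewrite -(lE q).
  rewrite big_split /= -mulr_suml w1 mul1r 2!mulrDl lerD2r.
  apply: le_trans wxy _; rewrite le_eqVlt; apply/orP; left; apply/eqP.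
  by field; rewrite !gt_eqF.
Qed.

Lemma doubling_cover n k (x : M) r : doubling M n -> 0 <= r ->
  exists2 s : seq M, (size s <= n ^ k)%N &
    forall y, mdist x y <= 2 ^+ k * r -> exists2 z, z \in s & mdist z y <= r.
Proof.
move=> dM r0; elim: k x => [|k IH] x.
  exists [:: x] => // y; rewrite expr0 mul1r => xy; exists x => //.
  by rewrite mem_head.
have rk0 : 0 <= 2 ^+ k * r by rewrite mulr_ge0// exprn_ge0.
have [y yP] := dM _ x rk0; have /choice[s sP] : forall i, exists s : seq M,
    (size s <= n ^ k)%N /\
    forall u, mdist (y i) u <= 2 ^+ k * r -> exists2 z, z \in s & mdist z u <= r.
  by move=> i; have [s ? ?] := IH (y i); exists s.
exists (flatten [seq s i | i <- enum 'I_n]).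
  rewrite size_flatten /shape -map_comp sumnE big_map expnS.
  apply: (@leq_trans (\sum_(i <- enum 'I_n) n ^ k)%N).
    by apply: leq_sum => i _ /=; case: (sP i).
  by rewrite big_const_seq count_predT size_enum_ord iter_addn_0 mulnC.
move=> u; rewrite exprS -mulrA => xu; have [i _ iu] := yP u xu.
have [z zs zu] := (sP i).2 u iu; exists z => //.
by apply/flattenP; exists (s i) => //; apply/mapP; exists i; rewrite // mem_enum.
Qed.

(** Finite r-nets of the balls of radius 2^k r about x0 form together a countable net; a point is
    coded by the position (k, index) of a nearby net point. Such codes serve as labels. *)
Lemma doubling_code n r : doubling M n -> 0 < r ->
  exists code : M -> nat, forall x y, code x = code y -> mdist x y <= 2 * r.
Proof.
move=> dM r0; have [[x0 _]|M0] := pselect (exists x0 : M, True); last first.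
  by exists (fun=> 0%N) => x; exfalso; apply: M0; exists x.
have /choice[s sP] : forall k, exists s : seq M, forall y,
    mdist x0 y <= 2 ^+ k * r -> exists2 z, z \in s & mdist z y <= r.
  by move=> k; have [s _ ?] := doubling_cover k x0 dM (ltW r0); exists s.
have /choice[c cP] : forall y, exists ki : nat * nat,
    mdist (nth x0 (s ki.1) ki.2) y <= r.
  move=> y; have [k ky] : exists k, mdist x0 y <= 2 ^+ k * r.
    exists (Num.truncn (mdist x0 y / r)).+1.
    rewrite -ler_pdivrMr// (le_trans (ltW (truncnS_gt _)))//.
    by rewrite -natrX ler_nat ltnW// ltn_expl.
  have [z zs zy] := sP k y ky; exists (k, index z (s k)).
  by rewrite /= nth_index.
exists (pickle \o c) => x y /(pcan_inj pickleK) cxy.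
apply: le_trans (metric_triangle _ (nth x0 (s (c x).1) (c x).2) _) _.
rewrite metric_sym (_ : 2 * r = r + r); last by ring.
by rewrite lerD// ?cP// cxy cP.
Qed.

Lemma maximal_separated (U : set M) r : exists A : set M,
  [/\ A `<=` U, forall a b, A a -> A b -> a <> b -> r <= mdist a b &
      forall x, U x -> 0 < r -> exists2 a, A a & mdist x a < r].
Proof.
pose P (A : set M) := A `<=` U /\
  forall a b, A a -> A b -> a <> b -> r <= mdist a b.
have [|A [[AU Ar] Amax]] := @Zorn_bigcup M P.
  move=> F FP Ft; split=> [x [A FA Ax]|a b [A FA Aa] [B FB Bb] ab].
    by have [AU _] := FP A FA; exact: AU.
  have [AB|BA] := Ft A B FA FB.
    by have [_ h] := FP B FB; apply: h => //; exact: AB.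
  by have [_ h] := FP A FA; apply: h => //; exact: BA.
exists A; split=> // x Ux r0; apply: contrapT => h.
have far a : A a -> r <= mdist x a.
  by move=> Aa; rewrite leNgt; apply/negP => xa; apply: h; exists a.
have nAx : ~ A x by move=> Ax; apply: h; exists x; rewrite // mdistxx.
apply: (Amax (A `|` [set x])).
  split=> [a Aa|/(_ x)]; first by left.
  by move=> h'; apply: nAx; apply: h'; right.
split=> [a [/AU//|->//]|a b [Aa|->] [Ab|->]//].
- exact: Ar.
- by move=> _; rewrite metric_sym; exact: far.
- by move=> _; exact: far.
Qed.

(** Pigeonhole: a covering ball of radius r contains at most one of the points. *)
Lemma separated_size n k (x : M) r (N : nat) (a : 'I_N -> M) :
  doubling M n -> 0 <= r -> (forall i, mdist x (a i) <= 2 ^+ k * r) ->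
  (forall i j, i <> j -> 2 * r < mdist (a i) (a j)) -> (N <= n ^ k)%N.
Proof.
move=> dM r0 xa sep; have [s sn sP] := doubling_cover k x dM r0.
have /choice[c cP] : forall i, exists c : 'I_(size s), mdist (nth x s c) (a i) <= r.
  move=> i; have [z zs zi] := sP _ (xa i).
  have h : (index z s < size s)%N by rewrite index_mem.
  by exists (Ordinal h); rewrite /= nth_index.
apply: leq_trans sn; rewrite -[N]card_ord -[leqRHS]card_ord.
apply: (@leq_card _ _ c) => i j cij; apply: contrapT => /sep.
apply/negP; rewrite -leNgt.
apply: le_trans (metric_triangle _ (nth x s (c i)) _) _.
rewrite metric_sym (_ : 2 * r = r + r); last by ring.
by rewrite lerD// cij.
Qed.

(** The guard [S x] admits the empty set even when M has no point to serve as a centre. *)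
Definition in_ball r : set (set M) := [set S | forall x, S x ->
  exists a, forall y, S y -> mdist a y <= r].

(* The net points of colour q form a maximal 3r-separated subset of the points
   farther than r/2 from the net points of the previous colours.  A point left
   uncovered by all colours would have one net point of every colour within 3r,
   and these are r/2-separated: too many for a doubling space. *)
Lemma doubling_system n r : doubling M n -> 0 < r ->
  system (in_ball r) r (4 * (n ^ 4).+1%:R).
Proof.
move=> dM r0; have r30 : 0 < 3 * r by lra.
have /choice[mx mxP] : forall U : set M, exists A : set M,
  [/\ A `<=` U, forall a b, A a -> A b -> a <> b -> 3 * r <= mdist a b &
      forall x, U x -> exists2 a, A a & mdist x a < 3 * r].
  move=> U; have [A [h1 h2 h3]] := maximal_separated U (3 * r).
  by exists A; split=> // x Ux; exact: h3.
pose step (U : set M) := U `\` [set x | exists2 a, mx U a & mdist x a <= r / 2].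
pose U i := iter i step setT; pose A i := mx (U i).
have Udecr i j : (i <= j)%N -> U j `<=` U i.
  move=> /subnK <-; elim: (j - i)%N => // k IH x; rewrite addSn /U iterS => -[+ _].
  exact: IH.
have AU i j a : (i < j)%N -> A j a -> forall b, A i b -> r / 2 < mdist a b.
  move=> ij Aa b Ab; have [/(_ a Aa) + _ _] := mxP (U j).
  move=> /(Udecr _ _ ij); rewrite /U iterS => -[_ h].
  by rewrite ltNge; apply/negP => ab; apply: h; exists b.
set Q := (n ^ 4).+1.
have cover x : exists i : 'I_Q, exists2 a, A i a & mdist x a <= r / 2.
  apply: contrapT => h.
  have Ux i : (i <= Q)%N -> U i x.
    elim: i => [//|i IH iQ]; rewrite /U iterS; split; first exact/IH/ltnW.
    by move=> [a Aa xa]; apply: h; exists (Ordinal iQ), a.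
  have /choice[a aP] : forall i : 'I_Q, exists a, A i a /\ mdist x a < 3 * r.
    move=> i; have [_ _ /(_ x) []] := mxP (U i); first exact/Ux/ltnW.
    by move=> a; exists a.
  suff : (Q <= n ^ 4)%N by rewrite ltnn.
  (* At radius r/4 the separation required is r/2, and 3r <= 2^4 (r/4): hence the exponent 4. *)
  apply: (@separated_size n 4 x (r / 4) Q a dM).
  - by rewrite divr_ge0// ltW.
  - by move=> i; have [_ /ltW xa] := aP i; rewrite (le_trans xa)//; lra.
  - move=> i j ij; have -> : 2 * (r / 4) = r / 2 by field.
    case: (ltngtP i j) => [lt|lt|/val_inj//].
      by rewrite metric_sym; apply: (AU _ _ _ lt); [case: (aP j)|case: (aP i)].
    by apply: (AU _ _ _ lt); [case: (aP i)|case: (aP j)].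
have [code codeP] := doubling_code dM r0.
pose near (i : 'I_Q) x a := A i a /\ mdist x a < r.
pose c (i : 'I_Q) x := xget x (near i x).
have sepA (i : 'I_Q) a b : A i a -> A i b -> mdist a b < 3 * r -> a = b.
  move=> Aa Ab ab; apply: contrapT => nab; have [_ /(_ a b Aa Ab nab) + _] := mxP (U i).
  by rewrite leNgt ab.
have cE (i : 'I_Q) x a : near i x a -> c i x = a.
  move=> [Aa xa]; rewrite /c; case: xgetP => [b _ [Ab xb]|/(_ a)[]//].
  apply: (sepA i) => //; apply: le_lt_trans (metric_triangle _ x _) _.
  by rewrite metric_sym; lra.
(* A tent of height r around each net point of colour i. The 3r-separation leaves at most one of
   them within r of x. *)
pose f (i : 'I_Q) x : R := if `[< exists a, near i x a >] then r - mdist x (c i x) else 0.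
have fE (i : 'I_Q) x a : near i x a -> f i x = r - mdist x a.
  move=> xa; rewrite /f (_ : `[< _ >] = true) ?(cE _ _ _ xa)//.
  by apply/asboolP; exists a.
have fpos (i : 'I_Q) x : 0 < f i x -> exists2 a, near i x a & c i x = a.
  by rewrite /f; case: asboolP => [[a xa] _|]; [exists a => //; exact: cE|rewrite ltxx].
have f0 i x : 0 <= f i x.
  rewrite /f; case: asboolP => [[a xa]|//]; rewrite (cE _ _ _ xa) subr_ge0.
  by case: xa => _ /ltW.
have fsum x : r / 2 <= \sum_i f i x.
  have [i [a Aa xa]] := cover x.
  have xa' : near i x a by split=> //; rewrite (le_lt_trans xa)//; lra.
  rewrite (bigD1 i)//= (fE _ _ _ xa').
  apply: (@le_trans _ _ (r - mdist x a)); first by lra.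
  by rewrite lerDl sumr_ge0.
have fL (i : 'I_Q) x y : mdist x y < r -> `|f i x - f i y| <= mdist x y.
  move=> xy.
  have half u v : mdist u v < r -> f i u - f i v <= mdist u v.
    move=> uv; have fv := f0 i v.
    have [fu|fu] := leP (f i u) 0; first by have := mdist_ge0 u v; lra.
    have [a [Aa ua] _] := fpos i u fu; rewrite (fE _ _ a)//.
    have va := metric_triangle v u a; rewrite (metric_sym v u) in va.
    have [va'|va'] := ltP (mdist v a) r; first by rewrite (fE _ _ a)//; lra.
    by have := metric_triangle u v a; lra.
  have h1 := half x y xy; have h2 := half y x; rewrite metric_sym in h2.
  by have {}h2 := h2 xy; rewrite ler_norml; apply/andP; split; lra.
have labE (i : 'I_Q) x y : 0 < f i x -> 0 < f i y ->
    mdist (c i x) (c i y) < 3 * r -> c i x = c i y.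
  move=> /fpos[a [Aa _] ->] /fpos[b [Ab _] ->]; exact: (sepA i).
have F0 x : 0 < \sum_i f i x by rewrite (lt_le_trans _ (fsum x))// divr_gt0.
have fF i x : 0 < f i x / (\sum_i f i x) -> 0 < f i x.
  by rewrite pmulr_lgt0// invr_gt0.
exists 'I_Q, (fun i x => f i x / \sum_i f i x), (fun i x => code (c i x)); split.
- by move=> i x; rewrite divr_ge0// ltW.
- by move=> x; rewrite -mulr_suml mulfV// gt_eqF.
- move=> i l x [/fF fx <-]; exists (c i x) => y [/fF fy cy].
  (* Equal codes place the two net points within 2r, less than their separation 3r, so they
     coincide. *)
  rewrite (labE i x y)//; last first.
    by rewrite (le_lt_trans (codeP _ _ (esym cy)))//; lra.
  by have [a [_ ya] ->] := fpos i y fy; rewrite metric_sym ltW.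
- move=> x y xy; split=> [i /fF fx /fF fy|].
    rewrite (labE i x y)//.
    have [a [_ xa] ->] := fpos i x fx; have [b [_ yb] ->] := fpos i y fy.
    have := metric_triangle a x b; have := metric_triangle x y b.
    by rewrite (metric_sym a x); lra.
  apply: le_trans (normalize_lipschitz _ _ _ (fsum x) (fsum y)) _ => //.
    by rewrite divr_gt0.
  apply: (@le_trans _ _ (2 / (r / 2) * (Q%:R * mdist x y))); last first.
    by rewrite le_eqVlt; apply/orP; left; apply/eqP; field; rewrite gt_eqF.
  rewrite ler_wpM2l//; first by rewrite divr_ge0// divr_ge0// ltW.
  rewrite mulr_natl -[Q in leRHS]card_ord -sumr_const.
  by apply: ler_sum => i _; exact: fL.
Qed.

End systems.

(** * Sampling a random partition *)

Section random_order.
Local Close Scope classical_set_scope.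
Context {T : finType}.
Implicit Types (pi : {perm T}) (A B U : {set T}).

Definition first pi A : option T :=
  [pick e in A | [forall f in A, enum_rank (pi e) <= enum_rank (pi f)]]%N.

Lemma first_some pi A : (0 < #|A|)%N -> exists2 e, first pi A = Some e & e \in A.
Proof.
move=> /card_gt0P[e0 e0A]; rewrite /first; case: pickP => [e /andP[eA _]|h].
  by exists e.
have := h [arg min_(e < e0 in A) enum_rank (pi e)].
case: arg_minnP => // e eA emin; rewrite eA /= => /negP[].
by apply/forall_inP.
Qed.

Lemma firstP pi A e : reflect
  (e \in A /\ forall f, f \in A -> (enum_rank (pi e) <= enum_rank (pi f))%N)
  (first pi A == Some e).
Proof.
rewrite /first; case: pickP => [f /andP[fA /forall_inP fmin]|h]; last first.
  apply: (iffP eqP) => // -[eA emin]; have := h e.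
  by rewrite eA /= => /negP[]; exact/forall_inP.
apply: (iffP eqP) => [[<-]//|[eA emin]]; congr Some.
apply: (@perm_inj _ pi); apply: enum_rank_inj; apply: val_inj => /=.
by apply/eqP; rewrite eqn_leq fmin//= emin.
Qed.

(** Composing with the transposition of e and f exchanges the orders that put e first with those
    that put f first, so all elements of U are equally likely. *)
Lemma card_first U e : e \in U ->
  (#|[set pi | first pi U == Some e]| * #|U| = #|{perm T}|)%N.
Proof.
move=> eU.
have cardE f : f \in U -> #|[set pi | first pi U == Some f]| =
    #|[set pi | first pi U == Some e]|.
  move=> fU; rewrite -(card_imset _ (mulgI (tperm e f))).
  apply: eq_card => pi; rewrite [RHS]inE; apply/imsetP/idP => [[rho]|piU].
    rewrite inE => /firstP[_ fmin] ->; apply/firstP; split=> // g gU.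
    rewrite !permM tpermL; apply: fmin; case: tpermP => //.
  exists (tperm e f * pi)%g; last by rewrite mulgA tperm2 mul1g.
  rewrite inE; apply/firstP; split=> // g gU; rewrite !permM tpermR.
  by have /firstP[_] := piU; apply; case: tpermP.
rewrite mulnC -sum_nat_const -(eq_bigr _ cardE).
rewrite -sum1_card (partition_big (fun pi => odflt e (first pi U)) (mem U)) /=.
  apply: eq_bigr => f fU; rewrite -sum1_card; apply: eq_bigl => pi; rewrite inE.
  have [|g -> _] := @first_some pi U; first by apply/card_gt0P; exists e.
  by [].
move=> pi _; have [|g -> //] := @first_some pi U.
by apply/card_gt0P; exists e.
Qed.

(** If the first element of the union U lies in both sets, it is first in both. So the outcomes
    differ only when it lies in the symmetric difference, and U has at least m elements. *)
Lemma card_first_neq A B (m : nat) : (m <= #|A|)%N -> (0 < m)%N ->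
  (0 < #|B|)%N ->
  (#|[set pi | first pi A != first pi B]| * m <=
   #|[set e | (e \in A) (+) (e \in B)]| * #|{perm T}|)%N.
Proof.
move=> mA m0 B0; pose U := A :|: B; set D := [set e | _ (+) _].
have mU : (m <= #|U|)%N by rewrite (leq_trans mA)// subset_leq_card// finset.subsetUl.
have U0 : (0 < #|U|)%N by rewrite (leq_trans m0).
apply: leq_trans (leq_mul (leqnn _) mU) _.
have sub : [set pi | first pi A != first pi B] \subset
    (\bigcup_(e in D) [set pi | first pi U == Some e])%SET.
  apply/fintype.subsetP => pi; rewrite inE => AB.
  have [e /eqP eU eUin] := first_some pi U0.
  apply/finset.bigcupP; exists e; last by rewrite inE.
  rewrite inE; apply: contraNT AB => eAB.
  have [eA eB] : e \in A /\ e \in B.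
    by move: eUin eAB; rewrite inE; case: (e \in A); case: (e \in B).
  have /firstP[_ emin] := eU.
  have /eqP -> : first pi A == Some e.
    by apply/firstP; split=> // f fA; apply: emin; rewrite inE fA.
  suff /eqP -> : first pi B == Some e by [].
  by apply/firstP; split=> // f fB; apply: emin; rewrite inE fB orbT.
have DU e : e \in D -> e \in U.
  by rewrite !inE; case: (e \in A); case: (e \in B).
apply: leq_trans (leq_mul (subset_leq_card sub) (leqnn _)) _.
apply: (@leq_trans ((\sum_(e in D) #|[set pi | first pi U == Some e]|) * #|U|)).
  rewrite leq_mul2r; apply/orP; right.
  elim/big_rec2: _ => [|e k X _ Xk]; first by rewrite cards0.
  apply: leq_trans (leq_card_setU _ _) _.
  by rewrite leq_add2l.
rewrite big_distrl /= -sum_nat_const leq_eqVlt; apply/orP; left; apply/eqP.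
by apply: eq_bigr => e /DU; exact: card_first.
Qed.

End random_order.

(** * Cutting a mass into unit pieces *)

Section clamp_sums.
Context {R : realType}.

Lemma clamp_le : {homo @clamp R : x y / x <= y}.
Proof. move=> x y xy; rewrite /clamp /Num.max /Num.min.
by repeat case: ifPn; rewrite -?leNgt; lra. Qed.

Lemma clamp_id (y : R) : 0 <= y <= 1 -> clamp y = y.
Proof. by move=> /andP[y0 y1]; rewrite /clamp (min_idPr y1) (max_idPr y0). Qed.

Lemma sum_clamp (m : nat) (y : R) : 0 <= y ->
  \sum_(j < m) clamp (y - j%:R) = Num.min y m%:R.
Proof.
move=> y0; elim: m => [|m IH]; first by rewrite big_ord0 (min_idPr y0).
rewrite big_ord_recr /= IH /clamp -natr1.
by have [ym|ym] := leP y m%:R; have [ym1|ym1] := leP y (m%:R + 1);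
  rewrite /Num.max /Num.min; repeat case: ifPn; rewrite -?leNgt; lra.
Qed.

(** Every clamped term is monotone, so the differences have one sign and the sum telescopes through
    [sum_clamp]. *)
Lemma sum_clamp_dist (m : nat) (y z : R) : 0 <= y <= m%:R -> 0 <= z <= m%:R ->
  \sum_(j < m) `|clamp (y - j%:R) - clamp (z - j%:R)| = `|y - z|.
Proof.
wlog zy : y z / z <= y.
  move=> W yI zI; have [/W->//|/W h] := orP (le_total z y).
  by rewrite distrC -h//; apply: eq_bigr => j _; rewrite distrC.
move=> /andP[y0 ym] /andP[z0 zm].
rewrite ger0_norm ?subr_ge0//.
rewrite -[in RHS](min_idPl ym) -[in RHS](min_idPl zm) -!sum_clamp// -sumrB.
by apply: eq_bigr => j _; rewrite ger0_norm// subr_ge0 clamp_le// lerD2r.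
Qed.

(** y - 1 is the sum of the clamped y - 1 - j, and such a term is 0 unless j + t < y because t <=
    1. *)
Lemma card_lt_ge (m : nat) (y t : R) : 0 <= y <= m%:R -> t <= 1 ->
  y - 1 <= #|[set j : 'I_m | (j%:R + t < y)%R]%SET|%:R.
Proof.
move=> /andP[y0 ym] t1; have [y1|y1] := leP y 1.
  by apply: (@le_trans _ _ 0); rewrite ?ler0n ?subr_le0.
have y10 : 0 <= y - 1 by lra.
rewrite (_ : y - 1 = Num.min (y - 1) m%:R); last by rewrite (elimT min_idPl)//; lra.
rewrite -sum_clamp// -sum1_card natr_sum big_mkcond [leRHS]big_mkcond /=.
apply: ler_sum => j _; rewrite inE; case: ifPn => [_|]; first exact: clamp_le1.
by rewrite -leNgt => h; rewrite /clamp ge_max lexx ge_min; apply/orP; right; lra.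
Qed.

End clamp_sums.

Section uniform_nat.
Context {R : realType} (N : nat).

(** The atoms are 0, ..., N, never an empty set; a set of permutations is therefore sampled with N
    one less than its size. *)
Definition uniform_nat : set nat -> \bar R :=
  mscale (N.+1%:R^-1)%:nng (msum (fun i : nat => dirac i) N.+1).

HB.instance Definition _ := Measure.on uniform_nat.

Lemma uniform_natE (A : set nat) :
  uniform_nat A = (N.+1%:R^-1 * \sum_(i < N.+1) \1_A (i : nat))%:E.
Proof.
rewrite /uniform_nat /mscale /= /msum EFinM; congr (_ * _)%E.
by rewrite -sumEFin; apply: eq_bigr => i _; rewrite /= diracE indicE.
Qed.

Let uniform_natT : uniform_nat [set: nat] = 1%E.
Proof.
rewrite uniform_natE (eq_bigr (fun=> 1)); last by move=> i _; rewrite indicT.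
by rewrite sumr_const card_ord mulVf// pnatr_eq0.
Qed.

HB.instance Definition _ := @Measure_isProbability.Build _ _ R
  uniform_nat uniform_natT.

End uniform_nat.

(** * Measurability from one-sided openness *)

Section right_open.
Context {R : realType}.

(** The open sets of the Sorgenfrey line: stable under arbitrary unions, yet Borel. *)
Definition right_open (U : set R) := forall t, U t ->
  exists2 e, 0 < e & forall t', t <= t' < t + e -> U t'.

(* A right-open set differs from its interior by a countable set: distinct such
   points start disjoint open intervals, each of which contains a rational. *)
Lemma right_open_measurable (U : set R) : right_open U ->
  measurable (U : set (measurableTypeR R)).
Proof.
move=> Uo; have -> : U = U^° `|` (U `\` U^°).
  by apply/esym/setDUK; exact: interior_subset.
apply: measurableU; first by apply: open_measurable; exact: open_interior.
apply: countable_measurable; first by move=> t; exact: measurable_set1.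
have /choice[q qP] : forall t, exists q : rat, U t ->
    exists2 e, t < ratr q < t + e & forall t', t <= t' < t + e -> U t'.
  move=> t; have [Ut|nUt] := pselect (U t); last by exists 0.
  have [e e0 eU] := Uo t Ut; have tte : t < t + e by rewrite ltrDl.
  by have [q] := rat_in_itvoo tte; rewrite in_itv /= => tq; exists q => _; exists e.
apply/countable_injP; exists (pickle \o q) => t u.
wlog tu : t u / t < u.
  move=> W tD uD tuE; have [tu|ut|//] := ltgtP t u; first exact: W.
  by apply/esym/W.
move=> /set_mem[Ut _] /set_mem[Uu nUu] /= /(pcan_inj pickleK) qE; exfalso; apply: nUu.
have [e /andP[_ qe] eU] := qP t Ut; have [e' /andP[uq _] _] := qP u Uu.
have ute : u < t + e by rewrite (lt_trans _ qe)// qE.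
rewrite /interior /=.
have : \forall z \near u, z \in `]t, (t + e)[.
  by apply: near_in_itvoo; rewrite in_itv /= tu ute.
apply: filterS => z; rewrite in_itv /= => /andP[tz ze].
by apply: eU; rewrite (ltW tz).
Qed.

Lemma measurable_slices (S : set (measurableTypeR R * nat)) :
  (forall i, right_open [set t | S (t, i)]) -> measurable S.
Proof.
move=> So; have -> : S = \bigcup_i ([set t | S (t, i)] `*` [set i]).
  apply/seteqP; split=> [[t i] Sti|[t i] [j _] [/= Sti ->]//].
  by exists i.
apply: bigcupT_measurable => i; apply: measurableX => //.
exact: right_open_measurable.
Qed.

Lemma positive_lower_bound (T : finType) (f : T -> R) : (forall e, 0 < f e) ->
  exists2 d, 0 < d & forall e, d <= f e.
Proof.
move=> f0; exists (\big[Num.min/1]_e f e).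
  by elim/big_ind : _ => // x y x0 y0; rewrite lt_min x0.
by move=> e; rewrite (bigD1 e)//= ge_min lexx.
Qed.

End right_open.

Section sampling.
Context {R : realType} {M : metricType R} {Q : finType}.
Variables (w : Q -> M -> R) (lab : Q -> M -> nat).
Hypothesis w0 : forall q x, 0 <= w q x.
Hypothesis w1 : forall x, \sum_q w q x = 1.

(** Rounding costs each colour at most one piece, so of a total mass m = 2 #|Q| at least #|Q| pieces
    are active. The ratio m/#|Q| is the factor 2 in [sampling_separates]. *)
Let m := #|Q|.*2.
Local Notation T := (Q * 'I_m)%type.

(* The mass w q x is cut into m * w q x pieces of mass 1/m, the last of which is
   incomplete and kept with probability its relative size. *)
Definition active (t : R) (x : M) : {set T} :=
  [set e : T | (e.2%:R + clamp t < m%:R * w e.1 x)%R]%SET.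

Definition order_of (i : nat) : {perm T} := nth 1%g (enum {perm T}) i.

Definition sample (o : R * nat) (x : M) : option T :=
  first (order_of o.2) (active o.1 x).

(** The piece number is forgotten, while the colour is kept next to its label: equal values mean
    equal colour and equal [lab]. By [sampleP] the default 0 never arises. *)
Definition sample_label (o : R * nat) (x : M) : nat :=
  oapp (fun e : T => pickle (e.1, lab e.1 x)) 0%N (sample o x).

Let wle1 q x : w q x <= 1.
Proof. by rewrite -(w1 x) (bigD1 q)//= lerDl sumr_ge0. Qed.

Lemma card_active t x : (#|Q| <= #|active t x|)%N.
Proof.
rewrite -(ler_nat R).
have -> : #|active t x|%:R =
    \sum_q #|[set j : 'I_m | (j%:R + clamp t < m%:R * w q x)%R]%SET|%:R :> R.
  rewrite -natr_sum -sum1_card; congr _%:R.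
  under [RHS]eq_bigr => q _ do rewrite -sum1_card.
  rewrite [RHS]pair_big_dep /=; apply: eq_bigl => -[q j] /=.
  by rewrite !finset.inE.
have -> : #|Q|%:R = \sum_q (m%:R * w q x - 1).
  by rewrite sumrB -mulr_sumr w1 mulr1 sumr_const /m -addnn natrD addrK.
apply: ler_sum => q _; apply: card_lt_ge; last exact: clamp_le1.
by rewrite mulr_ge0//= ler_piMr.
Qed.

(** As t grows pieces can only drop out, and the strict inequality keeps an active one in for a
    while. *)
Lemma active_right_cst t x : exists2 e, 0 < e &
  forall t', t <= t' < t + e -> active t' x = active t x.
Proof.
pose gap (e : T) := m%:R * w e.1 x - e.2%:R - clamp t.
(* Pieces without a positive gap are inactive and get the harmless value 1, so that a positive
   minimum exists. *)
have gap0 (e : T) : 0 < (if 0 < gap e then gap e else 1) by case: ifP.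
have [d d0 dE] := positive_lower_bound gap0.
exists d => // t' /andP[tt' t'd]; apply/setP => e; rewrite !finset.inE.
have ct := clamp_le tt'.
have ctd : clamp t' < clamp t + d.
  have := clamp_lipschitz t' t; rewrite !ger0_norm ?subr_ge0//; lra.
apply/idP/idP => h; first by rewrite (le_lt_trans _ h)// lerD2l.
have := dE e; rewrite (_ : 0 < gap e); last by rewrite /gap; lra.
by rewrite /gap => ?; lra.
Qed.

Lemma sample_right_cst (o : R * nat) x : exists2 e, 0 < e &
  forall t', o.1 <= t' < o.1 + e -> sample (t', o.2) x = sample o x.
Proof.
have [e e0 eE] := active_right_cst o.1 x; exists e => // t' /eE.
by rewrite /sample /= => ->.
Qed.

(* Right-openness survives the uncountable union over E. *)
Lemma measurable_sample_label (E : set M) k :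
  measurable ([set o | exists2 x, E x & sample_label o x = k]
    : set (measurableTypeR R * nat)).
Proof.
apply: measurable_slices => i t [x Ex xk].
have [e e0 eE] := sample_right_cst (t, i) x; exists e => // t' /eE tE.
by exists x => //; move: xk; rewrite /sample_label tE.
Qed.

Lemma measurable_sample_label_neq x y :
  measurable ([set o | sample_label o x <> sample_label o y]
    : set (measurableTypeR R * nat)).
Proof.
apply: measurable_slices => i t /= nxy.
have [e e0 eE] := sample_right_cst (t, i) x.
have [e' e'0 eE'] := sample_right_cst (t, i) y.
exists (Num.min e e'); first by rewrite lt_min e0.
move=> t' /andP[tt' t'e] /=; rewrite /sample_label (eE t') ?(eE' t')//.
  by rewrite tt' (lt_le_trans t'e)// lerD2l ge_min lexx orbT.
by rewrite tt' (lt_le_trans t'e)// lerD2l ge_min lexx.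
Qed.

Let Q0 (x : M) : (0 < #|Q|)%N.
Proof.
rewrite lt0n; apply/eqP => Q0; have := w1 x.
rewrite big1 => [/eqP|q]; first by rewrite eq_sym oner_eq0.
by have := card0_eq Q0 q; rewrite !inE.
Qed.

Lemma sampleP o x : exists2 e, sample o x = Some e & 0 < w e.1 x.
Proof.
have [e eE] := first_some (order_of o.2) (leq_trans (Q0 x) (card_active o.1 x)).
rewrite finset.inE => h; exists e => //; move: h.
have m0 : 0 < m%:R :> R by rewrite ltr0n double_gt0 (Q0 x).
by rewrite -(pmulr_rgt0 _ m0); apply: le_lt_trans; rewrite addr_ge0// clamp_ge0.
Qed.

Lemma sample_label_eq o x y : sample_label o x = sample_label o y ->
  exists q, [/\ 0 < w q x, 0 < w q y & lab q x = lab q y].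
Proof.
rewrite /sample_label; have [e -> ex] := sampleP o x.
have [f -> fy] := sampleP o y => /= /(pcan_inj pickleK)[ef lE].
by move: fy lE; rewrite -ef => fy lE; exists e.1.
Qed.

Definition sampling_prob : probability (measurableTypeR R * nat)%type R :=
  (uniform_prob (@ltr01 R) \x uniform_nat #|{perm T}|.-1)%E.

Let N0 : (0 < #|{perm T}|)%N.
Proof. by apply/card_gt0P; exists 1%g. Qed.

Let differ x y (e : T) : set (measurableTypeR R) :=
  [set t | (e \in active t x) (+) (e \in active t y)].

Let measurable_differ x y e : measurable (differ x y e).
Proof.
apply: right_open_measurable => t txy.
have [d d0 dE] := active_right_cst t x.
have [d' d'0 dE'] := active_right_cst t y.
exists (Num.min d d'); first by rewrite lt_min d0.
move=> t' /andP[tt' t'd]; rewrite /differ /= dE ?dE'//.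
  by rewrite tt' (lt_le_trans t'd)// lerD2l ge_min lexx orbT.
by rewrite tt' (lt_le_trans t'd)// lerD2l ge_min lexx.
Qed.

(** A piece is active at just one of x and y only when t lies between the two clamped thresholds. *)
Let differ_measure x y e :
  (lebesgue_measure (differ x y e `&` [set` `[0%R, 1%R]]) <=
   `|clamp (m%:R * w e.1 x - e.2%:R) - clamp (m%:R * w e.1 y - e.2%:R)|%:E)%E.
Proof.
set a := m%:R * w e.1 x - e.2%:R; set b := m%:R * w e.1 y - e.2%:R.
pose lo := Num.min (clamp a) (clamp b); pose hi := Num.max (clamp a) (clamp b).
have lohi : lo <= hi by rewrite ge_min le_max lexx.
have -> : `|clamp a - clamp b| = hi - lo.
  rewrite /hi /lo; have [ab|ab] := leP (clamp a) (clamp b).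
    by rewrite ler0_norm ?opprB// subr_le0.
  by rewrite gtr0_norm// subr_gt0.
have <- : lebesgue_measure `[lo, hi]%classic = (hi - lo)%:E.
  rewrite lebesgue_measure_itv /= lte_fin; case: ltP => // hilo.
  by rewrite (le_anti (introT andP (conj lohi hilo))) subrr.
apply: le_measure.
- by apply: mem_set; apply: measurableI; [exact: measurable_differ|exact: measurable_itv].
- by apply: mem_set; exact: measurable_itv.
move=> t [txy t01']; have t01 : 0 <= (t : R) <= 1 by exact: t01'.
suff : lo <= (t : R) <= hi by exact.
move: txy; rewrite /differ /= !finset.inE.
have tE := clamp_id t01; have [t0 t1] := andP t01.
rewrite tE -!ltrBrDl -/a -/b /lo /hi ge_min le_max.
case: (ltP (t : R) a) => ta; case: (ltP (t : R) b) => // tb _.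
  have := clamp_le tb; have := clamp_le (ltW ta); rewrite tE => -> ->.
  by rewrite orbT.
have := clamp_le ta; have := clamp_le (ltW tb); rewrite tE => -> ->.
by rewrite orbT.
Qed.

(** Fubini: for fixed t, [card_first_neq] bounds the proportion of separating orders by the number
    of differing pieces over #|Q|. Integrated over t, the pieces of colour q contribute m |w q x - w
    q y|. *)
Lemma sampling_separates x y :
  (forall q, 0 < w q x -> 0 < w q y -> lab q x = lab q y) ->
  (sampling_prob [set o | sample_label o x <> sample_label o y] <=
   (2 * \sum_q `|w q x - w q y|)%:E)%E.
Proof.
move=> labE; set E := [set o | _].
have mE : measurable E by exact: measurable_sample_label_neq.
have Qx : 0 < #|Q|%:R :> R by rewrite ltr0n (Q0 x).
have step1 t : (@uniform_nat R #|{perm T}|.-1 (xsection E t) <=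
    (\sum_e #|Q|%:R^-1 * \1_(differ x y e) t)%:E)%E.
  rewrite uniform_natE prednK// lee_fin -mulr_sumr.
  set S1 := \sum_(i < _) _.
  pose F := [set e | (e \in active t x) (+) (e \in active t y)]%SET.
  rewrite [X in _ <= _ * X](_ : _ = #|F|%:R); last first.
    rewrite -sum1_card natr_sum [RHS]big_mkcond; apply: eq_bigr => e _.
    rewrite indicE finset.inE; have [dt|dt] := pselect (differ x y e t).
      by rewrite mem_set//; move: dt; rewrite /differ /= => ->.
    rewrite memNset//; move: dt; rewrite /differ /=.
    by case: ifP => // _ [].
  pose D := [set pi | first pi (active t x) != first pi (active t y)]%SET.
  have h : S1 <= #|D|%:R.
    have -> : #|D|%:R = \sum_(i < #|{perm T}|) (order_of i \in D)%:R :> R.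
      rewrite -sum1_card natr_sum big_mkcond -big_enum (big_nth 1%g) big_mkord.
      by rewrite -cardE; apply: eq_bigr => i _; rewrite /order_of; case: ifP.
    apply: ler_sum => i _; rewrite indicE ler_nat.
    have [it|it] := pselect (xsection E t i); last by rewrite memNset.
    rewrite mem_set// finset.inE; suff -> : first (order_of i) (active t x) !=
      first (order_of i) (active t y) by [].
    move: it => /set_mem; rewrite /E /=; apply: contra_notN => /eqP sE.
    rewrite /sample_label.
    have [e ex wx] := sampleP (t, i : nat) x.
    have [f fy wy] := sampleP (t, i : nat) y.
    move: ex fy; rewrite /sample /= sE => -> [ef] /=.
    by rewrite labE// ef.
  have N0R : 0 < #|{perm T}|%:R :> R by rewrite ltr0n.
  rewrite ler_pdivrMl//; apply: le_trans h _.
  rewrite [leRHS]mulrCA ler_pdivlMl// -!natrM ler_nat mulnC [leqRHS]mulnC.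
  apply: card_first_neq.
  - exact: card_active.
  - exact: Q0 x.
  - exact: leq_trans (Q0 x) (card_active t y).
have mF e : measurable_fun [set: measurableTypeR R]
    (fun t => (#|Q|%:R^-1 * \1_(differ x y e) t)%:E : \bar R).
  by apply/measurable_EFinP; apply: measurable_funM.
have F0 e t : 0 <= #|Q|%:R^-1 * \1_(differ x y e) t :> R.
  by rewrite mulr_ge0 ?invr_ge0.
apply: (@le_trans _ _ (\int[uniform_prob (@ltr01 R)]_t
    (\sum_e (#|Q|%:R^-1 * \1_(differ x y e) t)%:E))%E).
  apply: ge0_le_integral => //.
  - exact: measurable_fun_xsection.
  - by apply: emeasurable_sum.
  - by move=> t _; rewrite sumEFin; exact: step1.
rewrite integral_uniform; first last.
- by move=> t; apply: sume_ge0 => e _; rewrite lee_fin.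
- exact: emeasurable_sum.
rewrite subr0 invr1 mul1e ge0_integral_sum//; last first.
  by move=> e; exact: measurable_funTS.
have -> : (2 * \sum_q `|w q x - w q y|)%:E = (\sum_(e : T) (#|Q|%:R^-1 *
    `|clamp (m%:R * w e.1 x - e.2%:R) - clamp (m%:R * w e.1 y - e.2%:R)|)%:E)%E.
  rewrite sumEFin; congr EFin; rewrite -mulr_sumr.
  rewrite -(pair_big predT predT (fun q (j : 'I_m) =>
    `|clamp (m%:R * w q x - j%:R) - clamp (m%:R * w q y - j%:R)|)) /=.
  rewrite mulr_sumr [RHS]mulr_sumr; apply: eq_bigr => q _.
  rewrite sum_clamp_dist ?mulr_ge0 ?ler_piMr//.
  rewrite -mulrBr normrM ger0_norm// mulrA; congr (_ * _).
  by rewrite /m -muln2 natrM mulrA mulVf ?mul1r// gt_eqF.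
apply: lee_sum => e _.
under eq_integral => t _ do rewrite EFinM.
rewrite ge0_integralZl//; last first.
  apply: measurable_funTS; apply/measurable_EFinP; apply: measurable_indic.
  exact: measurable_differ.
rewrite integral_indic//.
rewrite EFinM; apply: lee_wpmul2l; first by rewrite lee_fin invr_ge0.
exact: differ_measure.
Qed.

End sampling.

Section system_sampling.
Context {R : realType} {M : metricType R}.

Lemma cluster_at_label (T : Type) (label : T -> M -> nat) o x :
  cluster_at (clusters (fun k o => [set x | label o x = k]) o) x =
  [set y | label o y = label o x].
Proof.
rewrite /cluster_at; case: xgetP => [_ -> [[k _ <-] <-//]|].
by move=> /(_ [set y | label o y = label o x])[]; split=> //; exists (label o x).
Qed.

(** Cluster k is the set of points with sampled label k. Below distance r the Lipschitz bound of the
    system applies; from r on the claimed bound is at least 2 s >= 1. *)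
Lemma system_separating (adm : set (set M)) (r s : R) : 0 < r -> 1 <= s ->
  (forall S, adm S -> forall x y, S x -> S y -> mdist x y <= 2 * r) ->
  system adm r s ->
  exists (d : measure_display) (Omega : measurableType d)
         (P : probability Omega R) (Gamma : nat -> Omega -> set M),
    [/\ random_partition Gamma, bounded_partition (2 * r) Gamma &
        separating (4 * s) (2 * r) P Gamma].
Proof.
move=> r0 s1 admr [Q [w [lab [w0 w1 wA wL]]]].
pose label := sample_label w lab.
exists _, (measurableTypeR R * nat)%type, (@sampling_prob R Q).
exists (fun k o => [set x | label o x = k]); split.
- split=> [k E _|o].
    have := measurable_sample_label w lab E k; congr measurable.
    by apply/seteqP; split=> o [x] /=; [move=> Ex xk; exists x|move=> [Ex xk]; exists x].
  split.
  + by apply/seteqP; split=> // x _; exists [set y | label o y = label o x] => //=;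
      split; [exists (label o x)|move=> h; have : set0 x by rewrite -h].
  + move=> _ _ [[k _ <-] _] [[l _ <-] _] [x [/= <- <-]]; reflexivity.
  + by move=> A [_ /eqP/set0P].
- move=> o x; rewrite cluster_at_label /diam.
  apply: ge_ereal_sup => _ [[y z] /= [yx zx] <-].
  rewrite lee_fin; have [q [qy qz lyz]] := sample_label_eq w0 w1 (etrans yx (esym zx)).
  by apply: (admr _ (wA q (lab q z))).
- move=> x y.
  have -> : [set o | cluster_at (clusters (fun k o => [set x | label o x = k]) o) x <>
      cluster_at (clusters (fun k o => [set x | label o x = k]) o) y] =
      [set o | label o x <> label o y].
    apply/seteqP; split=> o /=; rewrite !cluster_at_label; apply: contra_not => h.
      by rewrite h.
    have : [set z | label o z = label o x] x by [].
    by rewrite h.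
  have [xy|xy] := ltP (mdist x y) r.
    have [labE wxy] := wL x y xy.
    apply: le_trans (sampling_separates w0 w1 labE) _; rewrite lee_fin.
    apply: (@le_trans _ _ (2 * (s / r * mdist x y))); first by rewrite ler_wpM2l.
    by rewrite le_eqVlt; apply/orP; left; apply/eqP; field; rewrite gt_eqF.
  apply: (@le_trans _ _ 1%E).
    exact: probability_le1 (measurable_sample_label_neq w lab x y).
  rewrite lee_fin (_ : _ * _ = 2 * s * (mdist x y / r)); last first.
    by field; rewrite gt_eqF.
  have : 1 <= mdist x y / r by rewrite ler_pdivlMr// mul1r.
  by nra.
Qed.

End system_sampling.

(** * Doubling subsets of L_p *)

Lemma constants_ge1 {R : realType} (p L : R) : 2 <= p -> 2^-1 <= L ->
  1 <= 100 ^+ 2 * L * p /\ 1 <= 7 * p * (100 ^+ 2 * L * p).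
Proof.
move=> p2 L2; have LP : 1 <= L * p by nra.
by split; nra.
Qed.

Section Lp_systems.
Context {d} {T : measurableType d} {R : realType}.
Variables (mu : {measure set T -> \bar R}) (p : R) (p1 : (1 <= p%:E)%E).
Hypothesis p2 : 2 <= p.
Variable D : set (LspaceType mu p1).
Local Notation M := (set_type D).

Let p0 : 0 < p. Proof. by apply: lt_le_trans p2. Qed.

Definition Lp_fun (x : M) : T -> R := (\val x : LspaceType mu p1).

Let Lp_fun_measurable x : measurable_fun [set: T] (Lp_fun x).
Proof. exact: Lspace_measurable. Qed.

Let Lp_int x y : (\int[mu]_t (`|Lp_fun x t - Lp_fun y t| `^ p)%:E =
  (mdist x y `^ p)%:E)%E.
Proof.
rewrite -poweR_EFin (_ : (mdist x y)%:E = Lnorm mu p%:E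
    (EFin \o (Lp_fun x \- Lp_fun y))); last exact: Lspace_distE.
by rewrite powR_Lnorm ?gt_eqF//; exact: eq_integral.
Qed.

Let Lp_intZ x y (e : R) : 0 < e ->
  (\int[mu]_t (`|(Lp_fun x t - Lp_fun y t) / e| `^ p)%:E =
  ((mdist x y / e) `^ p)%:E)%E.
Proof.
move=> e0; have ei : 0 <= e^-1 by rewrite invr_ge0 ltW.
transitivity (\int[mu]_t (((e^-1) `^ p)%:E *
    (`|Lp_fun x t - Lp_fun y t| `^ p)%:E))%E.
  apply: eq_integral => t _; rewrite -EFinM; congr EFin.
  by rewrite normrM (ger0_norm ei) powRM// mulrC.
rewrite ge0_integralZl//.
- by rewrite Lp_int -EFinM -powRM ?mdist_ge0// mulrC.
- apply/measurable_EFinP; apply: (measurableT_comp (measurable_powR p)) => //.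
  by apply: measurableT_comp => //; apply: measurable_funB; exact: Lp_fun_measurable.
- by rewrite lee_fin powR_ge0.
Qed.

Lemma Lp_unit_mdist x y (e : R) : 0 < e -> mdist x y <= e ->
  Lp_unit mu p (fun t => (Lp_fun x t - Lp_fun y t) / e).
Proof.
move=> e0 xy; split.
  by apply: measurable_funM => //; apply: measurable_funB; exact: Lp_fun_measurable.
rewrite Lp_intZ// lee_fin.
have h : mdist x y / e <= 1 by rewrite ler_pdivrMr// mul1r.
have := ge0_ler_powR (ltW p0) _ _ h; rewrite !nnegrE powR1 => -> //.
by rewrite divr_ge0 ?mdist_ge0// ltW.
Qed.

(** The centre is a measurable function and not a point of D, since recentring leaves D. *)
Definition Lp_ball (r : R) : set (set M) := [set S | exists2 c : T -> R,
  measurable_fun [set: T] c &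
  forall x, S x -> Lp_unit mu p (fun t => (Lp_fun x t - c t) / r)].

(** (x - y)/(2r) is half the difference of two functions of the unit ball, so midpoint convexity of
    the p-th power suffices. *)
Lemma Lp_ball_diam (r : R) S : 0 < r -> Lp_ball r S ->
  forall x y, S x -> S y -> mdist x y <= 2 * r.
Proof.
move=> r0 [c mc Sc] x y Sx Sy.
have [mx ux] := Sc x Sx; have [my uy] := Sc y Sy.
have r20 : 0 < 2 * r by rewrite mulr_gt0.
suff h : (mdist x y / (2 * r)) `^ p <= 1.
  rewrite -[leRHS]mul1r -ler_pdivrMr//.
  rewrite leNgt; apply/negP => lt1; move: h; apply/negP; rewrite -ltNge.
  have := gt0_ltr_powR p0 _ _ lt1; rewrite !nnegrE powR1; apply => //.
  by rewrite divr_ge0 ?mdist_ge0// ltW.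
have mpow (f : T -> R) : measurable_fun [set: T] f ->
    measurable_fun [set: T] (fun t => (`|f t| `^ p)%:E).
  move=> mf; apply/measurable_EFinP.
  by apply: (measurableT_comp (measurable_powR p)) => //; exact: measurableT_comp.
have h0 (f : T -> R) t : [set: T] t -> (0 <= (`|f t| `^ p)%:E)%E.
  by move=> _; rewrite lee_fin powR_ge0.
have := Lp_intZ x y r20; rewrite -lee_fin => <-.
apply: (@le_trans _ _ (\int[mu]_t (2^-1%:E *
    ((`|(Lp_fun x t - c t) / r| `^ p)%:E + (`|(Lp_fun y t - c t) / r| `^ p)%:E)))%E).
  apply: ge0_le_integral => //.
  - apply: (mpow (fun t => (Lp_fun x t - Lp_fun y t) / (2 * r))).
    by apply: measurable_funM => //; apply: measurable_funB; exact: Lp_fun_measurable.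
  - by apply: emeasurable_funM => //; apply: emeasurable_funD;
      [exact: (mpow _ mx)|exact: (mpow _ my)].
  - move=> t _; rewrite -EFinD -EFinM lee_fin [leRHS]mulrC.
    have -> : (Lp_fun x t - Lp_fun y t) / (2 * r) =
        ((Lp_fun x t - c t) / r - (Lp_fun y t - c t) / r) / 2.
      by field; rewrite gt_eqF.
    by apply: powR_midpoint; apply: le_trans p2; rewrite ler1n.
rewrite ge0_integralZl//; last 2 first.
- by apply: emeasurable_funD; [exact: (mpow _ mx)|exact: (mpow _ my)].
- by move=> t _; rewrite adde_ge0// lee_fin powR_ge0.
rewrite ge0_integralD//; [|exact: (mpow _ mx)|exact: (mpow _ my)].
have -> : (1 = 2^-1%:E * (1 + 1) :> \bar R)%E.
  by rewrite -EFinD -EFinM; congr EFin; lra.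
apply: lee_wpmul2l; first by rewrite lee_fin invr_ge0.
exact: (leeD ux uy).
Qed.

Lemma in_ball_Lp_ball (r : R) : 0 < r -> in_ball r `<=` Lp_ball r.
Proof.
move=> r0 S SB; have [[x Sx]|S0] := pselect (exists x, S x).
  have [a aS] := SB x Sx; exists (Lp_fun a) => [|y Sy]; first exact: Lp_fun_measurable.
  by apply: Lp_unit_mdist => //; rewrite metric_sym; exact: aS.
by exists (cst 0) => // x Sx; exfalso; apply: S0; exists x.
Qed.

Let K : R := 1 + (6 * p)^-1.

Let K1 : 1 < K.
Proof. by rewrite ltrDl invr_gt0 mulr_gt0. Qed.

Lemma Lp_ball_refine (N k : nat) (r : R) S : doubling M N -> (0 < N)%N ->
  0 < r -> 1024 * p <= 2 ^+ k -> Lp_ball (K * r) S ->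
  exists v : 'I_(N ^ k) -> M -> R,
    [/\ forall i x, 0 <= v i x,
        forall x, S x -> \sum_i v i x = 1,
        forall i, Lp_ball r [set x | S x /\ 0 < v i x] &
        forall x y, S x -> S y -> \sum_i `|v i x - v i y| <=
          100 ^+ 2 * Num.sqrt (ln ((N ^ k).*2%:R)) * p / r * mdist x y].
Proof.
move=> dM N0 r0 kp SB; have [c mc Sc] := SB.
have K0 : 0 < K by rewrite (lt_trans _ K1).
have [[x0 Sx0]|S0] := pselect (exists x, S x); last first.
  exists (fun _ _ => 0).
  split=> // [x Sx|i|x y Sx _]; try by exfalso; apply: S0; exists x.
  by exists (cst 0) => // x [Sx _]; exfalso; apply: S0; exists x.
set r' := K * r; have r'0 : 0 < r' by rewrite mulr_gt0.
have rr' : r <= r' by rewrite ler_peMl// ltW.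
have two0 : 0 < 2 ^+ k :> R by rewrite exprn_gt0.
(* S has diameter at most 2r' = 2^k r1, so N^k balls of radius r1 cover it. *)
pose r1 := 2 * r' / 2 ^+ k.
have r10 : 0 < r1 by rewrite divr_gt0// mulr_gt0.
have [s sN sP] := doubling_cover k x0 dM (ltW r10).
have Nk0 : (0 < N ^ k)%N by rewrite expn_gt0 N0.
move: sN; case NkE : (N ^ k)%N Nk0 => [//|n] _ sn.
pose X := set_type S.
(* Net points are moved into S, at the cost of doubling the radius: 2 r1 <= r'/(256 p). Balls that
   miss S leave the choice arbitrary. *)
have zP i : exists x : X, (exists2 y, S y & mdist (nth x0 s i) y <= r1) ->
    mdist (nth x0 s i) (\val x) <= r1.
  have [[y Sy yi]|h] := pselect (exists2 y, S y & mdist (nth x0 s i) y <= r1).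
    by exists (SigSub (mem_set Sy)).
  by exists (SigSub (mem_set Sx0)) => /h.
have /choice[z {}zP] := zP.
pose u (x : X) t := (Lp_fun (\val x) t - c t) / r'.
pose dX (x y : X) := mdist (\val x) (\val y) / r'.
have uu x : Lp_unit mu p (u x) by apply: Sc; exact: set_mem (valP x).
have dX0 x y : 0 <= dX x y by rewrite divr_ge0 ?mdist_ge0// ltW.
have dXe x y (e : R) : 0 < e -> dX x y <= e ->
    Lp_unit mu p (fun t => (u x t - u y t) / e).
  move=> e0 xye; have -> : (fun t => (u x t - u y t) / e) =
      (fun t => (Lp_fun (\val x) t - Lp_fun (\val y) t) / (e * r')).
    by apply/funext => t; rewrite /u; field; rewrite !gt_eqF.
  by apply: Lp_unit_mdist; [rewrite mulr_gt0|rewrite -ler_pdivrMr].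
have net x : exists i : 'I_n.+1, dX x (z i) <= (256 * p)^-1.
  have [y ys yx] : exists2 y, y \in s & mdist y (\val x) <= r1.
    apply: sP; rewrite /r1 mulrC divfK ?gt_eqF//.
    by apply: (Lp_ball_diam r'0 SB) => //; exact: set_mem (valP x).
  have iy : (index y s < n.+1)%N by rewrite (leq_trans _ sn)// index_mem.
  exists (Ordinal iy) => /=.
  have := zP (index y s); rewrite nth_index// => zi.
  have {}zi : mdist y (\val (z (index y s))) <= r1.
    by apply: zi; exists (\val x) => //; exact: set_mem (valP x).
  rewrite /dX ler_pdivrMr//.
  have := metric_triangle (\val x) y (\val (z (index y s))).
  rewrite (metric_sym _ y) => /le_trans; apply.
  apply: (le_trans (lerD yx zi)).
  have p256 : 0 < 256 * p by rewrite (pmulr_lgt0 _ p0) ltr0n.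
  rewrite ler_pdivlMl// /r1.
  have -> : 256 * p * (2 * r' / 2 ^+ k + 2 * r' / 2 ^+ k) =
     (1024 * p) * (r' / 2 ^+ k) by field; rewrite gt_eqF.
  apply: (le_trans (ler_wpM2r _ kp)); first by rewrite divr_ge0// ltW.
  by rewrite mulrC divfK// gt_eqF.
have [v [v0 v1 vS vL]] := Lp_local_partition p2 uu dX0 dXe net.
pose V i x := if pselect (S x) is left Sx then v i (SigSub (mem_set Sx)) else 0.
have VE i x (Sx : S x) : V i x = v i (SigSub (mem_set Sx)).
  rewrite /V; case: pselect => // Sx'; congr (v i _); exact: val_inj.
exists V; split.
- by move=> i x; rewrite /V; case: pselect.
- by move=> x Sx; under eq_bigr => i _ do rewrite (VE _ _ Sx); exact: v1.
(* The recentred centre: with r' = K r, dividing x minus it by r gives K (u x - u (z i)/p). *)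
- move=> i; exists (fun t => c t + p^-1 * (Lp_fun (\val (z i)) t - c t)).
    apply: measurable_funD => //; apply: measurable_funM => //.
    by apply: measurable_funB => //; exact: Lp_fun_measurable.
  move=> x [Sx]; rewrite (VE _ _ Sx) => /vS; congr Lp_unit.
  apply/funext => t; rewrite /u /= -/K.
  rewrite /r'; field.
  by rewrite !gt_eqF.
- move=> x y Sx Sy; under eq_bigr => i _ do rewrite (VE _ _ Sx) (VE _ _ Sy).
  apply: le_trans (vL _ _) _; rewrite -[leRHS]mulrA ler_wpM2l//.
    by rewrite !mulr_ge0 ?sqr_ge0 ?sqrtr_ge0// ltW.
  by rewrite /dX /= mulrC ler_wpM2r ?mdist_ge0// lef_pV2 ?posrE.
Qed.

Lemma Lp_system (N k : nat) (A : R) : doubling M N -> (0 < N)%N ->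
  1024 * p <= 2 ^+ k ->
  A = 100 ^+ 2 * Num.sqrt (ln ((N ^ k).*2%:R)) * p -> 0 < A ->
  forall r : R, 0 < r -> system (Lp_ball r) r (7 * p * A).
Proof.
move=> dM N0 kp AE A0.
have K0 : 0 < K by rewrite (lt_trans _ K1).
pose s0 : R := 4 * (N ^ 4).+1%:R.
(* A (6p + 1) = A K/(K - 1) is the fixed point of s -> s/K + A, and the initial excess shrinks by K
   at each step. Every scale admits the same [s0], so the iteration can start at K^m r. *)
have iterated m r : 0 < r ->
    system (Lp_ball r) r (s0 / K ^+ m + A * (6 * p + 1)).
  elim: m r => [|m IH] r r0.
    apply: (@system_monotone _ _ (in_ball r) _ r s0) => //.
    - rewrite expr0 divr1 lerDl mulr_ge0 ?(ltW A0)// addr_ge0//.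
      by rewrite mulr_ge0// ltW.
    - exact: in_ball_Lp_ball.
    - exact: doubling_system.
  have -> : s0 / K ^+ m.+1 + A * (6 * p + 1) =
      (s0 / K ^+ m + A * (6 * p + 1)) / K + A.
    rewrite exprS /K; field.
    by rewrite -/K expf_neq0 (gt_eqF p0, gt_eqF K0)// andbT gt_eqF// addr_gt0// mulr_gt0.
  apply: system_refine (IH _ (mulr_gt0 K0 r0)) _ => //; first exact: ltW K1.
    exact: ltW.
  by move=> S SB; rewrite AE; exact: Lp_ball_refine.
(* K^m >= m/(6p) by Bernoulli's inequality, so m of order 6p s0/A suffices. *)
have [m mE] : exists m, s0 / K ^+ m <= A.
  exists (Num.truncn (s0 / A * (6 * p))).+1; set m := _.+1.
  rewrite ler_pdivrMr ?exprn_gt0// -ler_pdivrMl// mulrC.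
  have mp : s0 / A * (6 * p) <= m%:R by rewrite ltW// truncnS_gt.
  have p60 : 0 < 6 * p by rewrite mulr_gt0.
  rewrite -ler_pdivlMr// in mp; apply: le_trans mp _.
  have : 1 + (6 * p)^-1 *+ m <= K ^+ m.
    rewrite /K; elim: (m) => [|i IH]; first by rewrite mulr0n addr0 expr0.
    have h0 : 0 <= (6 * p)^-1 by rewrite invr_ge0 ltW.
    have h1 : 0 <= (6 * p)^-1 *+ i by rewrite mulrn_wge0.
    rewrite mulrS exprS; set z := (6 * p)^-1 in IH h0 h1 *.
    apply: (@le_trans _ _ ((1 + z) * (1 + z *+ i))).
      by rewrite mulrDl !mulrDr !mul1r mulr1; have := mulr_ge0 h0 h1; lra.
    by rewrite ler_wpM2l// addr_ge0.
  by rewrite -[_^-1 *+ m]mulr_natl => h; apply: le_trans h; rewrite lerDr.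
move=> r r0; apply: system_monotone (iterated m r r0) => //.
(* The total is A (6p + 2), and 2 <= p. *)
apply: (le_trans (lerD mE (lexx _))).
have : A * 2 <= A * p by rewrite ler_pM2l.
rewrite -subr_ge0 => h; rewrite -subr_ge0; move: h.
by congr (0 <= _); ring.
Qed.

Lemma Lp_SEP (N k : nat) : doubling M N -> (0 < N)%N -> 1024 * p <= 2 ^+ k ->
  (SEP M <= (28 * 100 ^+ 2 * p ^+ 2 * Num.sqrt (ln ((N ^ k).*2%:R)))%:E)%E.
Proof.
move=> dM N0 kp; set L := Num.sqrt _.
have L12 : 2^-1 <= L.
  have l2 : 2^-1 <= ln (N ^ k).*2%:R :> R by rewrite ln_double_ge// expn_gt0 N0.
  rewrite /L -[leLHS]ger0_norm ?invr_ge0// -sqrtr_sqr; apply: ler_wsqrtr.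
  by apply: le_trans l2; rewrite expr2 ler_piMr// ?invr_ge0// invf_le1// ler1n.
pose A := 100 ^+ 2 * L * p.
have [A1 s1] : 1 <= A /\ 1 <= 7 * p * A by exact: constants_ge1.
apply: ereal_inf_lbound; exists (4 * (7 * p * A)); last first.
  by congr EFin; rewrite /A; ring.
have A0 : 0 < A by rewrite (lt_le_trans ltr01).
split=> /=.
  exact: mulr_ge0 (ler0n _ 4) (mulr_ge0 (mulr_ge0 (ler0n _ 7) (ltW p0)) (ltW A0)).
move=> Delta Delta0; have r0 : 0 < Delta / 2 by rewrite divr_gt0.
have sys := Lp_system dM N0 kp (erefl A) A0 r0.
have := system_separating r0 s1 (fun S SB => Lp_ball_diam r0 SB) sys.
by have -> : 2 * (Delta / 2) = Delta by rewrite mulrC divfK.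
Qed.

End Lp_systems.

(** * Size of the nets and conclusion *)

Lemma net_exponent {R : realType} (p : R) : 2 <= p -> exists2 k : nat,
  1024 * p <= 2 ^+ k & k.+1%:R <= 26 * ln p.
Proof.
move=> p2; have p0 : 0 < p by lra.
have exP : exists j : nat, p <= 2 ^+ j.
  exists (Num.truncn p).+1; rewrite (le_trans (ltW (truncnS_gt _)))//.
  by rewrite -natrX ler_nat ltnW// ltn_expl.
case: (ex_minnP exP) => -[|j] pj jmin; first by move: pj; rewrite expr0; lra.
have jp : 2 ^+ j < p by rewrite ltNge; apply/negP => /jmin; rewrite ltnn.
exists (10 + j.+1)%N.
  have e10 : 2 ^+ 10 = 1024 :> R by ring.
  by rewrite exprD e10; exact: ler_wpM2l (ler0n _ _) _ _ pj.
have h2 := @ln2_ge R.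
have lnp : ln 2 <= ln p by rewrite ler_ln ?posrE.
have jlnp : ln 2 *+ j <= ln p.
  by rewrite -lnXn// ler_ln ?posrE ?exprn_gt0// ltW.
have jj : j%:R <= 2 * ln p :> R.
  rewrite -[ln 2 *+ j]mulr_natr in jlnp; have j0 : 0 <= j%:R :> R by [].
  by nra.
rewrite (_ : (10 + j.+1).+1 = (12 + j)%N); last by rewrite addnS addSn.
by rewrite natrD; lra.
Qed.

(** The doubling of N^k costs ln 2 <= ln N, which the successor in k + 1 absorbs; 26 is then rounded
    up to the square 36. *)
Lemma ln_net_size {R : realType} (p lambda : R) (N k : nat) : (1 < N)%N ->
  N%:R <= lambda -> k.+1%:R <= 26 * ln p -> 0 <= ln p ->
  Num.sqrt (ln ((N ^ k).*2%:R)) <= 6 * Num.sqrt (ln p) * Num.sqrt (ln lambda).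
Proof.
move=> N1 Nl kp p0.
have N0 : 0 < N%:R :> R by rewrite ltr0n ltnW.
have l1 : 0 < ln N%:R :> R by rewrite ln_gt0// ltr1n.
have Nlam : ln N%:R <= ln lambda by rewrite ler_ln ?posrE// (lt_le_trans N0).
have l0 : 0 <= ln lambda by rewrite (le_trans (ltW l1)).
rewrite (_ : 6 = Num.sqrt 36); last first.
  by rewrite (_ : 36 = 6 ^+ 2 :> R) ?sqrtr_sqr ?ger0_norm//; lra.
rewrite -!sqrtrM ?mulr_ge0//; apply: ler_wsqrtr.
rewrite -muln2 natrM lnM ?posrE ?ltr0n ?expn_gt0 ?(ltnW N1)//.
rewrite natrX lnXn// -[_ *+ k]mulr_natl.
have : ln 2 <= ln N%:R :> R by rewrite ler_ln ?posrE// ler_nat.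
rewrite -natr1 in kp => h.
have : (k%:R + 1) * ln N%:R <= 26 * ln p * ln lambda.
  by rewrite ler_pM// ltW.
have := mulr_ge0 p0 l0.
by lra.
Qed.

Theorem theorem1p12 (R : realType) :
  exists2 C : R, 0 < C &
    forall (p lambda : R) (p2 : 2 <= p), 2 <= lambda ->
    forall D : set (L_ p2), rdoubling (set_type D) lambda ->
      (SEP (set_type D) <=
         (C * (p ^+ 2 * Num.sqrt (ln p)) * Num.sqrt (ln lambda))%:E)%E.
Proof.
exists (28 * 100 ^+ 2 * 6); first by rewrite !mulr_gt0 ?exprn_gt0.
move=> p lambda p2 l2 D dD.
have [k kp kln] := net_exponent p2.
have N1 : (1 < Num.truncn lambda)%N by rewrite truncn_ge_nat// (le_trans _ l2).
apply: (le_trans (Lp_SEP p2 dD (ltnW N1) kp)); rewrite lee_fin.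
have lp0 : 0 <= ln p by rewrite ln_ge0// (le_trans _ p2)// ler1n.
have Nl : (Num.truncn lambda)%:R <= lambda by rewrite truncn_le// (le_trans _ l2).
have := ln_net_size N1 Nl kln lp0.
set s1 := Num.sqrt _; set s2 := Num.sqrt (ln p); set s3 := Num.sqrt (ln lambda).
move=> h; have -> : 28 * 100 ^+ 2 * 6 * (p ^+ 2 * s2) * s3 =
  28 * 100 ^+ 2 * p ^+ 2 * (6 * s2 * s3) by ring.
exact: ler_wpM2l (mulr_ge0 (mulr_ge0 (ler0n _ 28) (sqr_ge0 _)) (sqr_ge0 _)) _ _ h.
Qed.
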